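(* Let $s>\frac12$, $a_0\in L^\infty_{loc}(\mathbf C^d)$, $0<t_0<1$ and $t_1=\frac1{4(1-t_0)}$. Then the following is true: (1) if $|a_0(w)|\lesssim e^{-r_0|w|^{1/s}}$ holds for all $r_0>0$, then $\mathrm{Op}^{\mathrm{aw}}_{\mathfrak V}(a_0):\mathcal A_{0,(s,t_0)}'(\mathbf C^d)\to\mathcal A_{0,(s,t_1)}(\mathbf C^d)$ is continuous; (2) if $|a_0(w)|\lesssim e^{-r_0|w|^{1/s}}$ holds for some $r_0>0$, then $\mathrm{Op}^{\mathrm{aw}}_{\mathfrak V}(a_0):\mathcal A_{(s,t_0)}'(\mathbf C^d)\to\mathcal A_{(s,t_1)}(\mathbf C^d)$ is continuous.
   Context: $(z,w)=\sum_jz_j\overline{w_j}$, $d\lambda$ is Lebesgue measure on $\mathbf C^d$, $A(\mathbf C^d)$ is the space of entire functions on $\mathbf C^d$, and $\lesssim$ means inequality up to a constant independent of $w$. The anti-Wick operator with symbol $a_0$ is $\mathrm{Op}^{\mathrm{aw}}_{\mathfrak V}(a_0)F(z)=\pi^{-d}\int_{\mathbf C^d}a_0(w)F(w)e^{(z-w,w)}\,d\lambda(w)$, $z\in\mathbf C^d$. For $s>\frac12$, $t>0$ and $r\in\mathbf R$, $\mathcal A_{s,t,r}(\mathbf C^d)$ is the Banach space of all $F\in A(\mathbf C^d)$ with $\|F\|_{\mathcal A_{s,t,r}}=\|F\cdot e^{-t|\cdot|^2+r|\cdot|^{1/s}}\|_{L^\infty}<\infty$. Set $$\mathcal A_{0,(s,t)}=\bigcap_{r>0}\mathcal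 A_{s,t,r},\qquad\mathcal A_{(s,t)}'=\bigcap_{r>0}\mathcal A_{s,t,-r}$$ with projective limit topologies, and $$\mathcal A_{(s,t)}=\bigcup_{r>0}\mathcal A_{s,t,r},\qquad\mathcal A_{0,(s,t)}'=\bigcup_{r>0}\mathcal A_{s,t,-r}$$ with inductive limit topologies. *)

(* Defs.v *)
From HB Require Import structures.
From mathcomp Require Import all_boot all_order all_algebra.
From mathcomp Require Import all_classical all_reals all_analysis.
From mathcomp Require Import complex.

Set Implicit Arguments.
Unset Strict Implicit.
Unset Printing Implicit Defensive.

Import Order.TTheory GRing.Theory Num.Theory.
Import numFieldNormedType.Exports.

Local Open Scope classical_set_scope.
Local Open Scope ring_scope.

Section LebesgueMeasure.
Context (R : realType).
Local Notation mR := (measurableTypeR R).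

Definition tcons n (p : n.-tuple mR * mR) : n.+1.-tuple mR :=
  [tuple of p.2 :: p.1].

Lemma measurable_tcons n : measurable_fun [set: n.-tuple mR * mR] (@tcons n).
Proof. exact: measurable_cons. Qed.

Definition leb_step n (m : {measure set (n.-tuple mR) -> \bar R}) :
    set (n.+1.-tuple mR) -> \bar R :=
  pushforward (m \x @lebesgue_measure R)%E (@tcons n).

Section leb_step_measure.
Context n (m : {measure set (n.-tuple mR) -> \bar R}).

Let mu : {measure set (n.-tuple mR * mR) -> \bar R} :=
  (m \x @lebesgue_measure R)%E.

Let leb_step0 : leb_step m set0 = 0%E.
Proof. exact: (measure0 mu). Qed.

Let leb_step_ge0 A : (0 <= leb_step m A)%E.
Proof. exact: (measure_ge0 mu). Qed.

Let leb_step_sigma_additive : semi_sigma_additive (leb_step m).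
Proof.
move=> F mF tF mUF; rewrite /leb_step /pushforward preimage_bigcup.
apply: (@measure_semi_sigma_additive _ _ _ mu).
- by move=> n'; rewrite -[X in measurable X]setTI; exact: measurable_tcons.
- apply/trivIsetP => /= i j _ _ ij; rewrite -preimage_setI.
  by move/trivIsetP : tF => /(_ _ _ _ _ ij) ->//; rewrite preimage_set0.
- by rewrite -preimage_bigcup -[X in measurable X]setTI; exact: measurable_tcons.
Qed.

HB.instance Definition _ := isMeasure.Build _ _ _ (leb_step m)
  leb_step0 leb_step_ge0 leb_step_sigma_additive.

End leb_step_measure.

(* Lebesgue measure on the Borel sets of R^n, as the n-fold product of the
   one-dimensional one. *)
Fixpoint leb n : {measure set (n.-tuple mR) -> \bar R} :=
  if n is n'.+1 then leb_step (leb n') else dirac [tuple].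

End LebesgueMeasure.
Arguments leb : clear implicits.

Section ComplexSpace.
Context (R : realType) (d : nat).

(* [R[i]^o] is [R[i]] seen as a normed space over itself; this is the copy of
   the complex numbers that carries a topology. *)
Local Notation C := (R[i]^o).
Local Notation Cd := 'rV[C]_d.
Local Notation normc := Normc.normc.

Definition herm (z w : Cd) : R[i] :=
  \sum_(j < d) (z 0 j : R[i]) * conjc (w 0 j).

(* The library norm on [Cd] is the sup norm; this is the Euclidean one. *)
Definition enorm (z : Cd) : R := Num.sqrt (\sum_(j < d) normc (z 0 j) ^+ 2).

Definition cexp (z : R[i]) : R[i] :=
  Complex (expR (complex.Re z) * cos (complex.Im z))
          (expR (complex.Re z) * sin (complex.Im z)).

(* Frechet differentiability over the field [R[i]] at every point. *)
Definition entire (F : Cd -> C) : Prop := forall z, differentiable F z.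

(* The identification of R^(2d) with C^d through which C^d receives its Borel
   sets and its Lebesgue measure. *)
Definition cvec (u : (d + d).-tuple (measurableTypeR R)) : Cd :=
  \row_(j < d) Complex (tnth u (lshift d j)) (tnth u (rshift d j)).

Local Notation lam := (leb R (d + d)).

Definition cmeasurable (f : Cd -> C) : Prop :=
  measurable_fun [set: _] (fun u => complex.Re (f (cvec u))) /\
  measurable_fun [set: _] (fun u => complex.Im (f (cvec u))).

Definition Linfty_loc (f : Cd -> C) : Prop :=
  cmeasurable f /\
  forall K : set Cd, compact K ->
    exists M : R, {ae lam, forall u, K (cvec u) -> normc (f (cvec u)) <= M}.

Definition cintegrable (f : Cd -> C) : Prop :=
  lam.-integrable [set: _] (fun u => (complex.Re (f (cvec u)))%:E) /\
  lam.-integrable [set: _] (fun u => (complex.Im (f (cvec u)))%:E).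

Definition cintegral (f : Cd -> C) : R[i] :=
  Complex (\int[lam]_u complex.Re (f (cvec u)))
          (\int[lam]_u complex.Im (f (cvec u))).

Definition aw_integrand (a0 F : Cd -> C) (z w : Cd) : C :=
  (a0 w : R[i]) * F w * cexp (herm (z - w) w).

Definition Op_aw (a0 F : Cd -> C) (z : Cd) : C :=
  ((pi ^- d)%:C)%C * cintegral (aw_integrand a0 F z).

Definition Anorm (s t r : R) (F : Cd -> C) : \bar R :=
  Lnorm lam +oo%E (fun u => (normc (F (cvec u)) *
    expR (- t * enorm (cvec u) ^+ 2 + r * enorm (cvec u) `^ s^-1))%:E).

Definition Aset (s t r : R) : set (Cd -> C) :=
  [set F | entire F /\ (Anorm s t r F < +oo)%E].

Definition Aspace (s t r : R) : Type := set_type (Aset s t r).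

Section norm_topology.
Context (s t r : R).
Implicit Types U : set (Aspace s t r).

Definition norm_open U : Prop := forall F, U F ->
  exists2 e : R, 0 < e &
    forall G : Aspace s t r, (Anorm s t r (sval G - sval F)%R < e%:E)%E -> U G.

Lemma norm_openT : norm_open setT.
Proof. by move=> F _; exists 1. Qed.

Lemma norm_openI : setI_closed norm_open.
Proof.
move=> U V oU oV F [/oU[e e0 eU] /oV[e' e'0 eV]].
exists (Order.min e e'); first by rewrite lt_min e0 e'0.
by move=> G; rewrite EFin_min lt_min => /andP[/eU ? /eV ?].
Qed.

Lemma norm_open_bigU (J : Type) (f : J -> set (Aspace s t r)) :
  (forall j, norm_open (f j)) -> norm_open (\bigcup_j f j).
Proof.
move=> of_ F [j _ /of_[e e0 eU]]; exists e => // G /eU fG.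
by exists j.
Qed.

HB.instance Definition _ := Choice.copy (Aspace s t r) (set_type (Aset s t r)).
HB.instance Definition _ := isOpenTopological.Build (Aspace s t r)
  norm_openT norm_openI norm_open_bigU.

End norm_topology.

Section limits.
Context (s t : R) (I : Type) (rho : I -> R).

Definition proj_lim : Type := set_type (\bigcap_i Aset s t (rho i)).

Definition proj_to (i : I) (F : proj_lim) : Aspace s t (rho i) :=
  exist _ (sval F) (mem_set (set_mem (svalP F) i Logic.I)).

HB.instance Definition _ :=
  Choice.copy proj_lim (set_type (\bigcap_i Aset s t (rho i))).
HB.instance Definition _ := Topological.copy proj_lim
  (sup_topology (fun i => Topological.class (initial_topology (proj_to i)))).

Definition ind_lim : Type := set_type (\bigcup_i Aset s t (rho i)).

Definition ind_from (i : I) (F : Aspace s t (rho i)) : ind_lim :=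
  exist _ (sval F) (mem_set (ex_intro2 _ _ i Logic.I (set_mem (svalP F)))).

Implicit Types U V : set ind_lim.

Definition absolutely_convex V : Prop := forall (F G H : ind_lim) (a b : R[i]),
  V F -> V G -> normc a + normc b <= 1 ->
  sval H = a *: sval F + b *: sval G -> V H.

(* The locally convex inductive limit topology, i.e. the finest locally convex
   topology for which all the inclusions [ind_from i] are continuous: a base of
   neighbourhoods of 0 is given by the absolutely convex sets whose trace on
   each step is a neighbourhood of 0 for the norm of that step. *)
Definition ind_nbhs0 V : Prop := absolutely_convex V /\
  forall i, exists2 e : R, 0 < e &
    forall F : Aspace s t (rho i), (Anorm s t (rho i) (sval F) < e%:E)%E -> V (@ind_from i F).

Definition ind_open U : Prop := forall F, U F ->
  exists2 V, ind_nbhs0 V &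
    forall G H : ind_lim, V H -> sval G = sval F + sval H -> U G.

Lemma ind_openT : ind_open setT.
Proof.
by move=> F _; exists setT => //; split=> // i; exists 1.
Qed.

Lemma ind_openI : setI_closed ind_open.
Proof.
move=> U U' oU oU' F [/oU[V [cV nV] VU] /oU'[V' [cV' nV'] VU']].
exists (V `&` V').
  split=> [G H K a b [VG V'G] [VH V'H] ab KE|i].
    by split; [exact: cV KE|exact: cV' KE].
  have [e e0 eV] := nV i; have [e' e'0 eV'] := nV' i.
  exists (Order.min e e'); first by rewrite lt_min e0 e'0.
  by move=> G; rewrite EFin_min lt_min => /andP[/eV ? /eV' ?].
by move=> G H [VH V'H] GE; split; [exact: VU GE|exact: VU' GE].
Qed.

Lemma ind_open_bigU (J : Type) (f : J -> set ind_lim) :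
  (forall j, ind_open (f j)) -> ind_open (\bigcup_j f j).
Proof.
move=> of_ F [j _ /of_[V nV VU]]; exists V => // G H VH GE.
by exists j => //; exact: VU GE.
Qed.

HB.instance Definition _ :=
  Choice.copy ind_lim (set_type (\bigcup_i Aset s t (rho i))).
HB.instance Definition _ := isOpenTopological.Build ind_lim
  ind_openT ind_openI ind_open_bigU.

End limits.

Definition calA0 (s t : R) := proj_lim s t (fun r : {posnum R} => r%:num).
Definition calA' (s t : R) := proj_lim s t (fun r : {posnum R} => - r%:num).
Definition calA (s t : R) := ind_lim s t (fun r : {posnum R} => r%:num).
Definition calA0' (s t : R) := ind_lim s t (fun r : {posnum R} => - r%:num).

(* Almost everywhere, since [a0] stands for a class modulo null sets. *)
Definition decays (s : R) (a0 : Cd -> C) (r0 : R) : Prop :=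
  exists M : R, {ae lam, forall u,
    normc (a0 (cvec u)) <= M * expR (- r0 * enorm (cvec u) `^ s^-1)}.

End ComplexSpace.

(* Main.v *)
Require Import Defs.
From HB Require Import structures.
From mathcomp Require Import all_boot all_order all_algebra.
From mathcomp Require Import all_classical all_reals all_analysis.
From mathcomp Require Import measurable_realfun ess_sup_inf complex.
From mathcomp Require Import ring lra.

(* Write [c = 1 - t0] and [p = 1/s], so [0 < p < 2]. The integrand is at most a
   constant times [exp (|z||w| - c|w|^2 - (r0 - r)|w|^p)]. Since
   [|z||w| - c|w|^2 = |z|^2/4c - c(|z|/2c - |w|)^2] with [1/4c = t1], the square
   pays for trading [rho |z|^p] against [rho (4c)^p |w|^p], which leaves
   [exp (t1|z|^2 - rho|z|^p) exp (- del|w|^p)] as soon as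
   [rho (4c)^p + r + del <= r0]. This is integrable in [w], and the resulting
   bound is linear in the norm of [F]: the operator maps the step [-r] of the
   source boundedly into the step [rho] of the target. If [a0] decays at every
   rate then all pairs [(r, rho)] occur; for a single rate [r0] some pair does.
   The same estimate applied to the second order Taylor remainder of
   [exp (z, w)] in [z] shows that the image is entire. *)

Import Order.TTheory GRing.Theory Num.Theory.
Import numFieldNormedType.Exports.

Local Open Scope classical_set_scope.
Local Open Scope ring_scope.

(** * Real estimates *)

Section RealEstimates.
Context {R : realType}.
Implicit Types (a b c e p x y k rho : R).

Lemma sin_norm_le x : `|sin x| <= `|x|.
Proof.
wlog x0 : x / 0 <= x.
  move=> H; have [/H//|/ltW x0] := leP 0 x.
  by rewrite -normrN -sinN -[leRHS]normrN H// oppr_ge0.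
have [y _ ] : exists2 y, y \in `[0, x] & sin x - sin 0 = cos y * (x - 0).
  apply: MVT_segment => //.
  exact/continuous_subspaceT/continuous_sin.
rewrite sin0 !subr0 => ->; rewrite normrM ler_piMl//.
by rewrite ler_norml cos_geN1 cos_le1.
Qed.

(** The half-angle identity [cos x - 1 = - 2 sin (x / 2) ^ 2] reduces this to the bound on [sin]. *)
Lemma cos_sub1_norm_le x : `|cos x - 1| <= x ^+ 2 / 2.
Proof.
have -> : cos x - 1 = - (2 * sin (x / 2) ^+ 2).
  have := cos2Dsin2 (x / 2); have <- : cos (x / 2 + x / 2) = cos x by rewrite -splitr.
  by rewrite cosD; nra.
rewrite normrN normrM ger0_norm// normrX.
have /(@lerXn2r _ 2) := sin_norm_le (x / 2).
rewrite !nnegrE !normr_ge0 => /(_ isT isT); rewrite !real_normK ?num_real//.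
rewrite expr_div_n; lra.
Qed.

(** Mean value theorem for [sin y - y]: its derivative [cos y - 1] is at most [|y|] by a second
    application. A quadratic bound is enough for the Taylor remainder of [cexp]. *)
Lemma sin_sub_norm_le x : `|sin x - x| <= x ^+ 2.
Proof.
wlog x0 : x / 0 <= x.
  move=> H; have [/H//|/ltW x0] := leP 0 x.
  by have := H (- x); rewrite sinN opprK sqrrN oppr_ge0 -normrN opprD opprK; exact.
have [y + ] : exists2 y, y \in `[0, x] &
    (sin x - x) - (sin 0 - 0) = (cos y - 1) * (x - 0).
  apply: (@MVT_segment _ (fun y => sin y - y) (fun y => cos y - 1)) => //.
  by apply: continuous_subspaceT => z; apply: cvgB => //; exact: continuous_sin.
rewrite in_itv/= sin0 !subr0 => /andP[y0 yx] ->.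
rewrite normrM (ger0_norm x0) expr2 ler_wpM2r//.
have : `|cos y - 1| <= `|y|.
  have [z _ ] : exists2 z, z \in `[0, y] & cos y - cos 0 = - sin z * (y - 0).
    apply: MVT_segment => //.
    exact/continuous_subspaceT/continuous_cos.
  rewrite cos0 subr0 => ->; rewrite normrM ler_piMl// normrN.
  by rewrite ler_norml sin_geN1 sin_le1.
by rewrite (ger0_norm y0) => /le_trans; apply.
Qed.

Lemma expR_sub1_norm_le x : `|expR x - 1| <= `|x| * expR `|x|.
Proof.
have := expR_ge1Dx x; have := expR_ge1Dx (- x).
have := expR_gt0 x; have : expR x * expR (- x) = 1 by rewrite -expRD subrr expR0.
have [x0|x0] := leP 0 x.
  by move=> *; rewrite (ger0_norm x0) ger0_norm; nra.
have : 1 <= expR (- x) by rewrite -expR0 ler_expR; lra.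
have : expR x <= 1 by rewrite -expR0 ler_expR; lra.
by move=> *; rewrite (ltr0_norm x0) ler0_norm; nra.
Qed.

(** Multiplying [1 - x <= expR (- x)] by [expR x] gives [expR x - 1 - x <= x * (expR x - 1)], to
    which the first order bound applies. *)
Lemma expR_sub1x_norm_le x : `|expR x - 1 - x| <= x ^+ 2 * expR `|x|.
Proof.
have := expR_ge1Dx x; have := expR_ge1Dx (- x).
have := expR_gt0 x; have : expR x * expR (- x) = 1 by rewrite -expRD subrr expR0.
move=> e1 e2 e3 e4; rewrite ger0_norm; last by lra.
have h : expR x - 1 - x <= x * (expR x - 1) by nra.
apply: (le_trans h); have := expR_sub1_norm_le x.
rewrite -(real_normK (num_real x)) => ?.
apply: le_trans (ler_norm _) _; rewrite normrM expr2 -mulrA.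
by rewrite ler_wpM2l.
Qed.

(** The threshold [X] solves [X ^ (2 - p) = 1 / e]. Above it the quadratic term dominates; below it
    [X ^ p] bounds the power. *)
Lemma powR_lt2_le_sqr p e : 0 < p < 2 -> 0 < e ->
  exists2 K : R, 0 <= K & forall x, 0 <= x -> x `^ p <= e * x ^+ 2 + K.
Proof.
move=> /andP[p0 p2] e0; pose X := e^-1 `^ (2 - p)^-1.
have X0 : 0 < X by rewrite powR_gt0// invr_gt0.
exists (X `^ p); first exact: powR_ge0.
move=> x x0; have [xX|Xx] := leP x X.
  apply: le_trans (ge0_ler_powR (ltW p0) _ _ xX) _; rewrite ?nnegrE ?(ltW X0)//.
  by rewrite lerDr mulr_ge0 ?sqr_ge0 ?ltW.
apply: le_trans (_ : e * x ^+ 2 <= _); last by rewrite lerDl powR_ge0.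
have xp : 0 < x := lt_trans X0 Xx.
have : e^-1 <= x `^ (2 - p).
  have : X `^ (2 - p) <= x `^ (2 - p).
    by apply: ge0_ler_powR; rewrite ?nnegrE ?ltW// subr_gt0.
  by rewrite -powRrM mulVf ?powRr1 ?invr_ge0 ?(ltW e0)// subr_eq0 gt_eqF.
rewrite powRB ?(gt_eqF xp) ?implybT// powR_mulrn// ler_pdivlMr ?powR_gt0//.
by rewrite ler_pdivrMl.
Qed.

(* If [x <= 4cy] the [rho]-terms compare directly; otherwise completing the
   square leaves [c (x/2c - y)^2 >= x^2/16c], which absorbs [rho x^p]. *)
Lemma mul_sub_sqr_le c p rho : 0 < c -> 0 < p < 2 -> 0 <= rho ->
  exists2 K : R, 0 <= K & forall x y, 0 <= x -> 0 <= y ->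
    x * y - c * y ^+ 2 <=
      (4 * c)^-1 * x ^+ 2 - rho * x `^ p + rho * (4 * c) `^ p * y `^ p + K.
Proof.
move=> c0 p02 rho0; have /andP[p0 p2] := p02.
(* With this [e] one has [rho * e <= 1 / (16 c)]; [rho + 1] keeps the denominator positive when
   [rho = 0]. *)
have e0 : 0 < ((rho + 1) * (16 * c))^-1 by rewrite invr_gt0 !mulr_gt0//; lra.
have [K K0 HK] := powR_lt2_le_sqr p _ p02 e0.
exists (rho * K) => [|x y x0 y0]; first exact: mulr_ge0.
have sq : (4 * c)^-1 * x ^+ 2 - (x * y - c * y ^+ 2) = c * (x / (2 * c) - y) ^+ 2.
  by field; rewrite gt_eqF.
have rK : 0 <= rho * K by exact: mulr_ge0.
have [xy|yx] := leP x (4 * c * y).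
  have : x `^ p <= (4 * c) `^ p * y `^ p.
    rewrite -powRM//; last by lra.
    by apply: ge0_ler_powR xy; rewrite ?nnegrE ?(ltW p0)//; nra.
  move=> /(ler_wpM2l rho0); rewrite mulrA.
  have := mulr_ge0 (ltW c0) (sqr_ge0 (x / (2 * c) - y)); lra.
have : rho * x `^ p <= (16 * c)^-1 * x ^+ 2 + rho * K.
  have /(ler_wpM2l rho0) := HK x x0; rewrite mulrDr => /le_trans; apply.
  rewrite lerD2r [leLHS]mulrA; apply: ler_wpM2r; first exact: sqr_ge0.
  rewrite invfM mulrA ler_piMl//.
    by rewrite invr_ge0; lra.
  by rewrite ler_pdivrMr; lra.
have : (16 * c)^-1 * x ^+ 2 <= c * (x / (2 * c) - y) ^+ 2.
  have -> : (16 * c)^-1 * x ^+ 2 = c * (x / (4 * c)) ^+ 2.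
    by field; rewrite gt_eqF.
  rewrite ler_pM2l// lerXn2r ?nnegrE ?divr_ge0//; [lra| |].
    rewrite subr_ge0 ler_pdivlMr; [nra|lra].
  rewrite lerBrDr -lerBrDl.
  have -> : x / (2 * c) - x / (4 * c) = x / (4 * c) by field; rewrite gt_eqF.
  by rewrite ler_pdivlMr; [lra|lra].
have : 0 <= rho * (4 * c) `^ p * y `^ p by rewrite !mulr_ge0 ?powR_ge0.
lra.
Qed.

(** Write [expR x] as the power [n.+1] of [expR (x / n.+1)] and use [y <= 1 + y <= expR y]. *)
Lemma expR_ge_exprn n x : 0 <= x -> (x / n.+1%:R) ^+ n.+1 <= expR x.
Proof.
move=> x0; rewrite [in leRHS](_ : x = n.+1%:R * (x / n.+1%:R)).
  rewrite expRM_natl lerXn2r ?nnegrE ?expR_ge0 ?divr_ge0//.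
  by apply: le_trans (expR_ge1Dx _); rewrite lerDr.
by rewrite mulrC divfK// pnatr_eq0.
Qed.

Lemma poly_le_expR_powR n p e : 0 < p -> 0 < e ->
  exists2 K : R, 0 <= K & forall y, 0 <= y ->
    expR (- (e * y `^ p)) <= K * (1 + y ^+ 2) ^- n.
Proof.
(* [m] is chosen so that [(y ^ p) ^ m.+1] dominates [y ^ (2 n)] for [y >= 1]. *)
move=> p0 e0; pose m := Num.truncn (2 * n%:R / p).
have mp : 2 * n%:R <= m.+1%:R * p.
  by rewrite -ler_pdivrMr// ltW// truncnS_gt.
(* [q] is the constant in [(y ^ p) ^ m.+1 <= q * expR (e * y ^ p)]. The summand 1 covers [y <= 1],
   and [2 ^ n] comes from bounding [1 + y ^ 2] by 2 or by [2 y ^ 2]. *)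
pose q := (e / m.+1%:R)^-1 ^+ m.+1; exists (2 ^+ n * (1 + q)).
  by rewrite mulr_ge0 ?exprn_ge0// addr_ge0// exprn_ge0// invr_ge0 divr_ge0// ltW.
have q0 : 0 <= q by rewrite exprn_ge0// invr_ge0 divr_ge0// ltW.
move=> y y0; have D0 : 0 < 1 + y ^+ 2 by rewrite ltr_pwDl ?sqr_ge0.
rewrite ler_pdivlMr ?exprn_gt0// expRN mulrC ler_pdivrMr ?expR_gt0//.
have t0 : 0 <= e * y `^ p by rewrite mulr_ge0 ?powR_ge0 ?ltW.
have [y1|/ltW y1] := leP y 1.
  apply: le_trans (_ : 2 ^+ n <= _).
    by rewrite lerXn2r ?nnegrE ?(ltW D0)//; nra.
  rewrite -mulrA ler_peMr ?exprn_ge0//.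
  by rewrite -[leLHS]mulr1 ler_pM// ?lerDl// -[leLHS]expR0 ler_expR.
apply: le_trans (_ : 2 ^+ n * (y `^ p) ^+ m.+1 <= _).
  apply: le_trans (_ : (2 * y ^+ 2) ^+ n <= _).
    by rewrite lerXn2r ?nnegrE ?(ltW D0)//; nra.
  rewrite exprMn ler_wpM2l ?exprn_ge0// -exprM -!powR_mulrn ?powR_ge0//.
  by rewrite -powRrM ler_powR// natrM mulrC// (mulrC p); lra.
rewrite -mulrA ler_wpM2l ?exprn_ge0//.
have := expR_ge_exprn m _ t0; rewrite mulrAC exprMn => h.
have dm : 0 < e / m.+1%:R by rewrite divr_gt0.
apply: le_trans (_ : q * expR (e * y `^ p) <= _); last first.
  by rewrite ler_wpM2r ?expR_ge0// lerDr.
by rewrite /q exprVn ler_pdivlMl ?exprn_gt0.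
Qed.

Lemma sqr_le_expR y : 0 <= y -> y ^+ 2 <= 4 * expR y.
Proof. by move=> /(expR_ge_exprn 1); rewrite expr_div_n; lra. Qed.

End RealEstimates.

(** * Lebesgue measure on tuples *)

Section LebesgueTuple.
Context {R : realType}.
Local Notation mR := (measurableTypeR R).
Local Notation mu := (@lebesgue_measure R).
Local Open Scope ereal_scope.

Lemma measurable_tnth_fun n (i : 'I_n) (g : R -> R) :
  measurable_fun [set: R] g ->
  measurable_fun [set: n.-tuple mR] (fun u => g (tnth u i)).
Proof.
move=> mg; apply: measurableT_comp mg _; exact: measurable_tnth.
Qed.

Lemma integral_oneDsqrV_lty : \int[mu]_x ((1 + x ^+ 2)^-1)%:E < +oo.
Proof.
have c : continuous (fun x : R => (1 + x ^+ 2)^-1)%R.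
  exact: continuous_oneDsqrV.
rewrite ge0_symfun_integralT//.
- rewrite (_ : [set x : R | _] = `[0%R, +oo[%classic); last first.
    by apply/seteqP; split => x /=; rewrite in_itv/= andbT.
  have := @integral0y_oneDsqr R; rewrite /oneDsqr => ->.
  by rewrite -EFinM ltry.
- by move=> x; rewrite invr_ge0 addr_ge0// sqr_ge0.
- by move=> x /=; rewrite sqrrN.
Qed.

(** These cubes exhaust the space and witness sigma-finiteness. By induction, the preimage of a cube
    under [tcons] is a smaller cube times an interval. *)
Lemma leb_cube n (k : nat) :
  leb R n [set u | forall i, (`|tnth u i : R| <= k%:R)%R] < +oo /\
  measurable [set u : n.-tuple mR | forall i, (`|tnth u i : R| <= k%:R)%R].
Proof.
have mN m : measurable [set u : m.-tuple mR | forall i, (`|tnth u i : R| <= k%:R)%R].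
  rewrite (_ : [set _ | _] = \bigcap_(i in [set: 'I_m])
      (fun u : m.-tuple mR => `|tnth u i : R|%R) @^-1` `]-oo, k%:R]); last first.
    by apply/seteqP; split => u /= H i; have := H i; rewrite /= in_itv/=; auto.
  apply: fin_bigcap_measurable => // i _.
  rewrite -[X in measurable X]setTI; exact: measurable_tnth_fun.
split=> //; elim: n => [|n IH] /=.
  by rewrite diracE ltry.
rewrite /leb_step /pushforward.
rewrite (_ : _ @^-1` _ = [set u | forall i, (`|tnth u i : R| <= k%:R)%R] `*`
   `[- k%:R, k%:R]%classic)%R; last first.
  apply/seteqP; split => -[u y] /= H.
    split=> [i|]; first by have := H (lift ord0 i); rewrite /tcons/= tnthS.
    by have := H ord0; rewrite /tcons/= ler_norml in_itv.
  move: H => [Hu Hy] i; case: (unliftP ord0 i) => [j|] ->.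
    by rewrite tnthS.
  by rewrite tnth0 ler_norml; rewrite in_itv/= in Hy.
rewrite product_measure1E//; last exact: mN.
apply: lte_mul_pinfty => //.
  by rewrite ge0_fin_numE.
suff : mu `[- k%:R, k%:R]%classic%R < +oo by [].
by rewrite lebesgue_measure_itv/=; case: ifP => _; rewrite ?ltry// -EFinB ltry.
Qed.

Lemma leb_sigma_finite n : sigma_finite [set: n.-tuple mR] (leb R n).
Proof.
exists (fun k : nat => [set u | forall i, (`|tnth u i : R| <= k%:R)%R]).
  apply/esym/seteqP; split => // u _.
  exists (Num.truncn (\sum_i `|tnth u i|)%R).+1 => //= i.
  apply: le_trans (ltW (truncnS_gt _)).
  by rewrite (bigD1 i)//= lerDl sumr_ge0.
by move=> k; have [] := leb_cube n k.
Qed.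

(** [leb] is declared only as a measure; its sigma-finiteness enters as a hypothesis, from which the
    required structure is packed locally. *)
Lemma sigma_finite_tonelli d1 d2 (T1 : measurableType d1) (T2 : measurableType d2)
  (m1 : {measure set T1 -> \bar R}) (m2 : {sigma_finite_measure set T2 -> \bar R})
  (f : (T1 * T2)%type -> \bar R) : sigma_finite [set: T1] m1 ->
  measurable_fun setT f -> (forall x, 0 <= f x) ->
  \int[m1 \x m2]_z f z = \int[m1]_x \int[m2]_y f (x, y).
Proof.
move=> s1 mf f0.
pose H1 := isSFinite.Build _ _ _ _ (sfinite_measure_sigma_finite s1).
pose H2 := isSigmaFinite.Build _ _ _ _ s1.
pose m1' := HB.pack_for (SigmaFiniteMeasure.type T1 R) (Measure.sort m1) H1 H2.
exact: (@fubini_tonelli1 _ _ _ _ _ m1' m2 f mf f0).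
Qed.

Lemma integral_leb_prod n (g : R -> R) : measurable_fun [set: R] g ->
  (forall x, (0 <= g x)%R) ->
  \int[leb R n]_u (\prod_(i < n) g (tnth u i))%:E = (\int[mu]_x (g x)%:E) ^+ n.
Proof.
move=> mg g0; have mP m : measurable_fun [set: m.-tuple mR]
    (fun u : m.-tuple mR => (\prod_(i < m) g (tnth u i))%R).
  by apply: measurable_prod => i _; exact: measurable_tnth_fun.
elim: n => [|n IH].
  rewrite integral_dirac//; last by apply/measurable_EFinP; exact: (mP 0%N).
  by rewrite diracT mul1e big_ord0 expe0.
rewrite /= ge0_integral_pushforward//=; last 3 first.
- exact: measurable_tcons.
- by apply/measurable_EFinP; exact: mP.
- by move=> u _; rewrite lee_fin prodr_ge0.
rewrite preimage_setT sigma_finite_tonelli//=; last 3 first.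
- exact: leb_sigma_finite.
- apply/measurable_EFinP; apply: measurableT_comp (mP _) _.
  exact: measurable_tcons.
- by move=> u; rewrite lee_fin prodr_ge0.
under eq_integral => u _.
  under eq_integral => y _.
    rewrite big_ord_recl EFinM /tcons/= tnth0.
    under eq_bigr do rewrite tnthS.
    over.
  rewrite ge0_integralZr//; last 3 first.
  - exact/measurable_EFinP.
  - by move=> *; rewrite lee_fin.
  - by rewrite lee_fin prodr_ge0.
  over.
rewrite /= ge0_integralZl//; last 3 first.
- by apply/measurable_EFinP; exact: mP.
- by move=> *; rewrite lee_fin prodr_ge0.
- by apply: integral_ge0 => *; rewrite lee_fin.
by rewrite IH; case: n {IH} => [|n]; rewrite ?expe0 ?mule1.
Qed.

End LebesgueTuple.

(** * Complex exponential and the Hermitian form *)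

Section ComplexNumbers.
Context {R : realType}.
Local Notation normc := Normc.normc.
Implicit Types x y : R[i].

Lemma normc_ge0 x : 0 <= normc x.
Proof. by case: x => a b; exact: sqrtr_ge0. Qed.

Lemma Re_norm_le_normc x : `|complex.Re x| <= normc x.
Proof.
case: x => a b /=; rewrite -sqrtr_sqr ler_sqrt ?addr_ge0 ?sqr_ge0//.
by rewrite lerDl sqr_ge0.
Qed.

Lemma Im_norm_le_normc x : `|complex.Im x| <= normc x.
Proof.
case: x => a b /=; rewrite -sqrtr_sqr ler_sqrt ?addr_ge0 ?sqr_ge0//.
by rewrite lerDr sqr_ge0.
Qed.

Lemma normc_real (a : R) : normc (a%:C)%C = `|a|.
Proof. by rewrite /= expr0n addr0 sqrtr_sqr. Qed.

Lemma normc_le_ReIm x : normc x <= `|complex.Re x| + `|complex.Im x|.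
Proof.
case: x => a b; rewrite [leLHS]/=; have p : 0 <= `|a| + `|b| by rewrite addr_ge0.
rewrite -[leRHS](ger0_norm p) -sqrtr_sqr ler_sqrt ?sqr_ge0//.
have := normr_ge0 a; have := normr_ge0 b.
rewrite -(real_normK (num_real a)) -(real_normK (num_real b)); nra.
Qed.

Lemma normc_conjc x : normc (conjc x) = normc x.
Proof. by case: x => a b; rewrite /= sqrrN. Qed.

Lemma normc_sum (I : Type) (r : seq I) (f : I -> R[i]) :
  normc (\sum_(i <- r) f i) <= \sum_(i <- r) normc (f i).
Proof.
elim/big_ind2: _ => //; first by rewrite Normc.normc0.
move=> a b c e ab ce; apply: le_trans (le_normcD _ _) _; exact: lerD.
Qed.

Lemma cexpD x y : cexp (x + y) = cexp x * cexp y.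
Proof.
case: x y => [a b] [c e]; rewrite /cexp /= expRD cosD sinD.
by apply/eqP; rewrite eq_complex /=; apply/andP; split; apply/eqP; ring.
Qed.

Lemma normc_cexp x : normc (cexp x) = expR (complex.Re x).
Proof.
rewrite /cexp /= !exprMn -mulrDr cos2Dsin2 mulr1 sqrtr_sqr.
by rewrite ger0_norm ?expR_ge0.
Qed.

(** Real and imaginary parts are split until only the real remainders of exp, cos and sin occur;
    each part contributes [2 N ^ 2 expR N] with [N = normc x]. *)
Lemma cexp_sub1x_normc_le x :
  normc (cexp x - 1 - x) <= 4 * normc x ^+ 2 * expR (normc x).
Proof.
apply: le_trans (normc_le_ReIm _) _.
have := Re_norm_le_normc x; have := Im_norm_le_normc x; have := normc_ge0 x.
move: (normc x) => N; case: x => a b; rewrite /cexp [complex.Re _]/= [complex.Im _]/=.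
move=> N0 bN aN; rewrite [complex.Re _]/= [complex.Im _]/= subr0.
have e0 := expR_ge0 N.
have aE : expR `|a| <= expR N by rewrite ler_expR.
have aE' : expR a <= expR N by rewrite ler_expR (le_trans (ler_norm a)).
have sq (c : R) : `|c| <= N -> c ^+ 2 <= N ^+ 2.
  by move=> cN; rewrite -real_normK ?num_real// lerXn2r ?nnegrE.
have a2 := sq _ aN; have b2 := sq _ bN.
have N2 := sqr_ge0 N.
have h1 : `|expR a * cos b - 1 - a| <= 2 * (N ^+ 2 * expR N).
  have -> : expR a * cos b - 1 - a = (expR a - 1 - a) + expR a * (cos b - 1).
    by ring.
  apply: le_trans (ler_normD _ _) _; rewrite mulr_natl mulr2n lerD//.
    apply: le_trans (expR_sub1x_norm_le a) _.
    by rewrite ler_pM ?sqr_ge0 ?expR_ge0.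
  rewrite normrM ger0_norm ?expR_ge0// mulrC ler_pM ?expR_ge0//.
  apply: le_trans (cos_sub1_norm_le b) _; have := sqr_ge0 b; lra.
have h2 : `|expR a * sin b - b| <= 2 * (N ^+ 2 * expR N).
  have -> : expR a * sin b - b = expR a * (sin b - b) + b * (expR a - 1).
    by ring.
  apply: le_trans (ler_normD _ _) _; rewrite mulr_natl mulr2n lerD//.
    rewrite normrM ger0_norm ?expR_ge0// mulrC ler_pM ?expR_ge0//.
    by apply: le_trans (sin_sub_norm_le b) _.
  rewrite normrM expr2 -mulrA ler_pM//.
  apply: le_trans (expR_sub1_norm_le a) _; rewrite ler_pM ?expR_ge0//.
lra.
Qed.

End ComplexNumbers.

Section HermitianSpace.
Context {R : realType} {d : nat}.
Local Notation C := (R[i]^o).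
Local Notation Cd := 'rV[C]_d.
Local Notation normc := Normc.normc.
Implicit Types z w h : Cd.

Lemma enorm_ge0 z : 0 <= enorm z.
Proof. exact: sqrtr_ge0. Qed.

Lemma enorm_sqr z : enorm z ^+ 2 = \sum_(j < d) normc (z 0 j) ^+ 2.
Proof. by rewrite sqr_sqrtr// sumr_ge0// => j _; exact: sqr_ge0. Qed.

Lemma normc_le_enorm z (j : 'I_d) : normc (z 0 j) <= enorm z.
Proof.
rewrite -(ger0_norm (normc_ge0 _)) -sqrtr_sqr ler_sqrt; last first.
  by rewrite sumr_ge0// => k _; exact: sqr_ge0.
by rewrite (bigD1 j)//= lerDl sumr_ge0// => k _; exact: sqr_ge0.
Qed.

(** Cauchy-Schwarz by the weighted inequality [2 a b <= (|w| / |z|) a ^ 2 + (|z| / |w|) b ^ 2],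
    summed over the coordinates. The weights divide by the norms, so vanishing norms are treated
    first. *)
Lemma herm_le z w : normc (herm z w) <= enorm z * enorm w.
Proof.
apply: le_trans (normc_sum _ _ _) _.
under eq_bigr do rewrite Normc.normcM normc_conjc.
have [z0|z0] := eqVneq (enorm z) 0.
  rewrite z0 mul0r big1// => j _; apply/eqP; rewrite mulf_eq0.
  by have := normc_le_enorm z j; rewrite z0 le_eqVlt ltNge normc_ge0 orbF => ->.
have [w0|w0] := eqVneq (enorm w) 0.
  rewrite w0 mulr0 big1// => j _; apply/eqP; rewrite mulf_eq0.
  by have := normc_le_enorm w j; rewrite w0 le_eqVlt ltNge normc_ge0 orbF => ->;
    rewrite orbT.
have x0 : 0 < enorm z by rewrite lt_neqAle eq_sym z0 enorm_ge0.
have y0 : 0 < enorm w by rewrite lt_neqAle eq_sym w0 enorm_ge0.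
apply: le_trans (_ : \sum_(j < d) (enorm w / enorm z * normc (z 0 j) ^+ 2 +
  enorm z / enorm w * normc (w 0 j) ^+ 2) / 2 <= _).
  apply: ler_sum => j _; set a := normc _; set b := normc _.
  have := sqr_ge0 (enorm w * a - enorm z * b).
  rewrite -(@pmulr_lge0 _ (enorm z * enorm w)^-1) ?invr_gt0 ?mulr_gt0// => H.
  rewrite -subr_ge0; apply: le_trans (_ : 0 <=
    (enorm w * a - enorm z * b) ^+ 2 * (enorm z * enorm w)^-1 / 2) _.
    by rewrite divr_ge0.
  by rewrite le_eqVlt; apply/orP; left; apply/eqP; field; rewrite z0 w0.
rewrite -mulr_suml big_split/= -!mulr_sumr -!enorm_sqr.
by rewrite le_eqVlt; apply/orP; left; apply/eqP; field; rewrite z0 w0.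
Qed.

Lemma hermDl z z' w : herm (z + z') w = herm z w + herm z' w.
Proof.
by rewrite -big_split; apply: eq_bigr => j _; rewrite mxE mulrDl.
Qed.

Lemma hermZl (a : C) z w : herm (a *: z) w = (a : R[i]) * herm z w.
Proof.
by rewrite /herm mulr_sumr; apply: eq_bigr => j _; rewrite mxE mulrA.
Qed.

Lemma hermBl z z' w : herm (z - z') w = herm z w - herm z' w.
Proof. by rewrite -scaleN1r hermDl hermZl mulN1r. Qed.

Lemma herm_self w : herm w w = ((enorm w ^+ 2)%:C)%C.
Proof.
rewrite enorm_sqr rmorph_sum; apply: eq_bigr => j _.
case: (w 0 j) => a b; rewrite /= sqr_sqrtr ?addr_ge0 ?sqr_ge0//.
by apply/eqP; rewrite eq_complex /=; apply/andP; split; apply/eqP; ring.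
Qed.

Lemma normc_cexp_herm_le z w :
  normc (cexp (herm (z - w) w)) <= expR (enorm z * enorm w - enorm w ^+ 2).
Proof.
rewrite normc_cexp ler_expR hermBl herm_self raddfB/= lerD2r.
apply: le_trans (ler_norm _) _; apply: le_trans (Re_norm_le_normc _) _.
exact: herm_le.
Qed.

End HermitianSpace.

(** * Measurability of functions on C^d *)

Section Measurability.
Context {R : realType} {d : nat}.
Local Notation C := (R[i]^o).
Local Notation Cd := 'rV[C]_d.
Local Notation normc := Normc.normc.
Local Notation mR := (measurableTypeR R).
Implicit Types (f g : Cd -> C) (z w h : Cd).

Lemma cmeasurable_cst (c : C) : cmeasurable (fun _ : Cd => c).
Proof. by split; exact: measurable_cst. Qed.

Lemma cmeasurableD f g :
  cmeasurable f -> cmeasurable g -> cmeasurable (fun w => f w + g w).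
Proof.
move=> [rf mf] [rg mg]; split.
- under eq_fun do rewrite raddfD; exact: measurable_funD.
- under eq_fun do rewrite raddfD; exact: measurable_funD.
Qed.

Lemma cmeasurableM f g :
  cmeasurable f -> cmeasurable g -> cmeasurable (fun w => (f w : R[i]) * g w).
Proof.
move=> [rf mf] [rg mg]; split.
- rewrite (_ : (fun _ => _) = fun u => complex.Re (f (cvec u)) * complex.Re (g (cvec u)) -
      complex.Im (f (cvec u)) * complex.Im (g (cvec u))).
    by apply: measurable_funB; exact: measurable_funM.
  by apply/funext => u; case: (f _) => a b; case: (g _).
- rewrite (_ : (fun _ => _) = fun u => complex.Re (f (cvec u)) * complex.Im (g (cvec u)) +
      complex.Im (f (cvec u)) * complex.Re (g (cvec u))).
    by apply: measurable_funD; exact: measurable_funM.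
  by apply/funext => u; case: (f _) => a b; case: (g _).
Qed.

Lemma cmeasurable_sum n (f : 'I_n -> Cd -> C) :
  (forall j, cmeasurable (f j)) -> cmeasurable (fun w => \sum_j f j w).
Proof.
move=> mf; elim: n f mf => [|n IH] f mf.
  under eq_fun do rewrite big_ord0; exact: cmeasurable_cst.
under eq_fun do rewrite big_ord_recl; apply: cmeasurableD => //.
exact: IH.
Qed.

Lemma cmeasurable_coord (j : 'I_d) : cmeasurable (fun w : Cd => w 0 j).
Proof.
split; under eq_fun do rewrite mxE /=; exact: measurable_tnth.
Qed.

Lemma cmeasurable_conj f : cmeasurable f -> cmeasurable (fun w => conjc (f w)).
Proof.
move=> [rf mf]; split.
  by rewrite (_ : (fun _ => _) = fun u => complex.Re (f (cvec u)))//;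
    apply/funext => u; case: (f _).
rewrite (_ : (fun _ => _) = fun u => - complex.Im (f (cvec u))).
  exact: measurable_funN.
by apply/funext => u; case: (f _).
Qed.

Lemma cmeasurable_herm z : cmeasurable (herm z).
Proof.
apply: cmeasurable_sum => j; apply: cmeasurableM.
  exact: (cmeasurable_cst (z 0 j)).
exact/cmeasurable_conj/cmeasurable_coord.
Qed.

Lemma cmeasurable_herm_self : cmeasurable (fun w : Cd => herm w w).
Proof.
apply: cmeasurable_sum => j; apply: cmeasurableM; first exact: cmeasurable_coord.
exact/cmeasurable_conj/cmeasurable_coord.
Qed.

Lemma cmeasurable_cexp f : cmeasurable f -> cmeasurable (fun w => cexp (f w)).
Proof.
move=> [rf mf].
have mE := measurableT_comp (@measurable_expR R) rf.
split; apply: measurable_funM => //=.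
  by apply: measurableT_comp mf; apply: continuous_measurable_fun; exact: continuous_cos.
by apply: measurableT_comp mf; apply: continuous_measurable_fun; exact: continuous_sin.
Qed.

Lemma measurable_normc f : cmeasurable f ->
  measurable_fun setT (fun u => normc (f (cvec u))).
Proof.
move=> [rf mf].
rewrite (_ : (fun _ => _) = Num.sqrt \o
  (fun u => complex.Re (f (cvec u)) ^+ 2 + complex.Im (f (cvec u)) ^+ 2)).
  apply: measurableT_comp.
    by apply: continuous_measurable_fun; exact: sqrt_continuous.
  by apply: measurable_funD; apply: measurable_funX.
by apply/funext => u /=; case: (f _).
Qed.

Lemma measurable_enorm :
  measurable_fun setT (fun u => enorm (cvec u : Cd)).
Proof.
apply: measurableT_comp; first by apply: continuous_measurable_fun; exact: sqrt_continuous.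
apply: measurable_sum => j; apply: measurable_funX.
exact: (measurable_normc _ (cmeasurable_coord j)).
Qed.

(** Radii in the topology of [Cd] are positive elements of [R[i]]. Positivity there forces a zero
    imaginary part, which is how a real radius is obtained. *)
Lemma continuous_coordP f z : {for z, continuous f} -> forall e : R, 0 < e ->
  exists2 r : R, 0 < r & forall w,
    (forall j, normc ((z 0 j : R[i]) - w 0 j) < r) -> normc ((f z : R[i]) - f w) < e.
Proof.
move=> /cvgrPdist_lt cf e e0.
have eC0 : (0 : C) < (e%:C)%C by rewrite ltcR.
have /nbhs_ballP[r r0 zr] := cf _ eC0.
have rR : r = ((complex.Re r)%:C)%C.
  by case: r r0 {zr} => a b /=; rewrite ltcE /= => /andP[/eqP ->].
exists (complex.Re r); first by rewrite -ltcR -rR.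
move=> w zw; rewrite -ltcR; apply: (zr w); split => // i j.
by rewrite ord1 /ball /= rR ltcR.
Qed.

(** Every preimage is a countable union of fibres of [i], whatever [g] is. *)
Lemma measurable_countable_comp dT (T : measurableType dT) (I : countType)
    (i : T -> I) (g : I -> R) :
  (forall v, measurable (i @^-1` [set v])) -> measurable_fun setT (g \o i).
Proof.
move=> mi _ Y mY; rewrite setTI.
rewrite (_ : _ @^-1` _ =
    \bigcup_(v in [set: I]) if `[< Y (g v) >] then i @^-1` [set v] else set0).
  apply: countable_bigcupT_measurable; first exact: countableP.
  by move=> v; case: ifPn.
apply/seteqP; split => x /=.
  by move=> Yx; exists (i x) => //; rewrite asboolT.
by move=> [v _]; case: ifPn => // /asboolP Yv /= ->.
Qed.

(** The fibre over [v] is a half-open box, hence a finite intersection of coordinate strips. *)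
Lemma measurable_floor_tuple n (k : nat) (v : n.-tuple int) :
  measurable ((fun u : n.-tuple mR => [tuple Num.floor (k.+1%:R * tnth u i) | i < n])
    @^-1` [set v]).
Proof.
rewrite (_ : _ @^-1` _ = \bigcap_(i in [set: 'I_n])
    ((fun u : n.-tuple mR => tnth u i) @^-1`
      `[(tnth v i)%:~R / k.+1%:R, (tnth v i + 1)%:~R / k.+1%:R[%classic)).
  apply: fin_bigcap_measurable => // i _; rewrite -[X in measurable X]setTI.
  exact: measurable_tnth.
have fl (x : R) m : (Num.floor (k.+1%:R * x) = m) <->
    (x \in `[m%:~R / k.+1%:R, (m + 1)%:~R / k.+1%:R[).
  rewrite in_itv/= ler_pdivrMr// ltr_pdivlMr// (mulrC x) -floor_eq.
  by split => [->|/eqP].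
apply/seteqP; split => u /=.
  by move=> uv i _ /=; apply/fl; rewrite -uv tnth_mktuple.
move=> H; apply: eq_from_tnth => i; rewrite tnth_mktuple.
by apply/fl; exact: H.
Qed.

(* Rounding the coordinates down to multiples of [1/k] makes a function take
   countably many values; a continuous function is the limit of these. *)
Lemma continuous_cmeasurable f : continuous f -> cmeasurable f.
Proof.
move=> cf.
pose ints k (u : (d + d).-tuple mR) :=
  [tuple Num.floor (k.+1%:R * tnth u i) | i < d + d].
pose pt k (v : (d + d).-tuple int) : (d + d).-tuple mR :=
  [tuple (tnth v i)%:~R / k.+1%:R | i < d + d].
(* [P] stands for the real or the imaginary part; only its Lipschitz bound matters. *)
have key (P : R[i] -> R) : (forall x y, `|P x - P y| <= normc (x - y)) ->
    measurable_fun setT (fun u => P (f (cvec u))).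
  move=> PL; apply: (@measurable_fun_cvg _ _ _ _
    (fun k => (fun v => P (f (cvec (pt k v)))) \o ints k)).
    by move=> k; apply: measurable_countable_comp; exact: measurable_floor_tuple.
  move=> u _; apply/cvgrPdist_lt => e e0.
  have [r r0 ur] := continuous_coordP _ _ (cf (cvec u)) _ e0.
  (* Rounding moves the real and the imaginary part of a coordinate by at most [1 / k.+1] each, so
     [2 / k.+1 < r] suffices. *)
  exists (Num.truncn (2 / r)) => // k /= Nk.
  apply: le_lt_trans (PL _ _) _; apply: ur => j; rewrite !mxE.
  apply: le_lt_trans (normc_le_ReIm _) _.
  have step i : `|tnth u i - tnth (pt k (ints k u)) i| <= k.+1%:R^-1.
    rewrite !tnth_mktuple; set x := tnth u i.
    have -> : x - (Num.floor (k.+1%:R * x))%:~R / k.+1%:R =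
        (k.+1%:R * x - (Num.floor (k.+1%:R * x))%:~R) / k.+1%:R.
      by field; rewrite nat1r.
    have /andP[h1 h2] := floor_itv (k.+1%:R * x).
    rewrite ger0_norm ?divr_ge0 ?subr_ge0// ler_pdivrMr// mulVf// lerBlDl.
    by apply: ltW; rewrite -intrD1.
  apply: le_lt_trans (_ : 2 * k.+1%:R^-1 < _).
    by rewrite mulr_natl mulr2n lerD//; exact: step.
  rewrite ltr_pdivrMr// -ltr_pdivrMl// mulrC.
  apply: lt_le_trans (truncnS_gt _) _.
  by rewrite ler_nat ltnS.
split; apply: key => x y; rewrite -raddfB.
  exact: Re_norm_le_normc.
exact: Im_norm_le_normc.
Qed.

End Measurability.

(** * Integration of complex functions *)

Section ComplexIntegral.
Context {R : realType} {d : nat}.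
Local Notation C := (R[i]^o).
Local Notation Cd := 'rV[C]_d.
Local Notation normc := Normc.normc.
Local Notation mR := (measurableTypeR R).
Local Notation lam := (leb R (d + d)).
Implicit Types (f g : Cd -> C) (z w h : Cd) (c : R[i]).

(** The function decays faster than [(1 + |w| ^ 2) ^- (d + d)]. Each real coordinate is at most
    [|w|], so this is bounded by the product of the [1 / (1 + u_i ^ 2)], whose integral is a power
    of a finite one-dimensional integral. *)
Lemma integrable_expR_enorm (p e : R) : 0 < p -> 0 < e ->
  lam.-integrable setT (fun u => (expR (- (e * enorm (cvec u : Cd) `^ p)))%:E).
Proof.
move=> p0 e0; have [K K0 HK] := poly_le_expR_powR (d + d) p e p0 e0.
have mg : measurable_fun [set: R] (fun x : R => (1 + x ^+ 2)^-1).
  by apply: continuous_measurable_fun; exact: continuous_oneDsqrV.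
have g0 (x : R) : 0 <= (1 + x ^+ 2)^-1 by rewrite invr_ge0 addr_ge0 ?sqr_ge0.
apply: (@le_integrable _ _ _ _ _ _ _
    (fun u : (d + d).-tuple mR => (K * \prod_(i < d + d) (1 + tnth u i ^+ 2)^-1)%:E)) => //.
- apply/measurable_EFinP; apply: (measurableT_comp (@measurable_expR R)).
  apply: measurable_funN; apply: measurable_funM; first exact: measurable_cst.
  apply: (measurableT_comp (@measurable_powR R p)); exact: measurable_enorm.
- move=> u _; rewrite !abse_EFin lee_fin ger0_norm ?expR_ge0//.
  have P0 : 0 <= \prod_(i < d + d) (1 + tnth u i ^+ 2)^-1 by exact: prodr_ge0.
  rewrite ger0_norm ?mulr_ge0//; apply: le_trans (HK _ (enorm_ge0 _)) _.
  rewrite ler_wpM2l// -[X in _ ^- X]card_ord -exprVn -prodr_const.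
  apply: ler_prod => i _; rewrite invr_ge0 addr_ge0 ?sqr_ge0//=.
  rewrite lef_pV2 ?posrE ?ltr_pwDl ?sqr_ge0// lerD2l enorm_sqr.
  have le_term (j : 'I_d) : normc ((cvec u : Cd) 0 j) ^+ 2 <=
      \sum_(j < d) normc ((cvec u : Cd) 0 j) ^+ 2.
    by rewrite [leRHS](bigD1 j)//= lerDl sumr_ge0// => k _; exact: sqr_ge0.
  rewrite -(real_normK (num_real (tnth u i))).
  case: (split_ordP i) => j ->; apply: le_trans (le_term j);
    rewrite lerXn2r ?nnegrE ?normc_ge0//.
    by have := Re_norm_le_normc ((cvec u : Cd) 0 j); rewrite !mxE.
  by have := Im_norm_le_normc ((cvec u : Cd) 0 j); rewrite !mxE.
- apply: (@eq_integrable _ _ _ _ _ _ (fun u : (d + d).-tuple mR =>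
    (K%:E * (\prod_(i < d + d) (1 + tnth u i ^+ 2)^-1)%:E)%E)) => //.
  apply: integrableZl => //.
  have mP : measurable_fun setT (fun u : (d + d).-tuple mR =>
      \prod_(i < d + d) (1 + tnth u i ^+ 2)^-1).
    by apply: measurable_prod => i _; exact: (measurable_tnth_fun _ i _ mg).
  apply/integrableP; split; first exact/measurable_EFinP.
  under eq_integral do rewrite abse_EFin ger0_norm ?prodr_ge0//.
  rewrite (integral_leb_prod _ _ mg g0).
  have := @integral_oneDsqrV_lty R; set I := (X in (X < _)%E) => Ioo.
  have I0 : (0 <= I)%E by apply: integral_ge0 => x _; rewrite lee_fin.
  suff: (I ^+ (d + d) < +oo)%E by [].
  have -> : I = (fine I)%:E by rewrite fineK// ge0_fin_numE.
  by rewrite -EFin_expe ltry.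
Qed.

Lemma ae_le_integrable (f : (d + d).-tuple mR -> R) (g : (d + d).-tuple mR -> R) :
  measurable_fun setT f -> lam.-integrable setT (EFin \o g) -> (forall u, 0 <= g u) ->
  {ae lam, forall u, `|f u| <= g u} ->
  lam.-integrable setT (EFin \o f) /\ `|\int[lam]_u f u| <= \int[lam]_u g u.
Proof.
move=> mf ig g0 fg; have /integrableP[mg goo] := ig.
have le : (\int[lam]_u `|(f u)%:E| <= \int[lam]_u (g u)%:E)%E.
  apply: ae_ge0_le_integral => //.
  - by apply: measurableT_comp => //; exact/measurable_EFinP.
  - by move=> u _; rewrite lee_fin.
  - by apply: filterS fg => u fg _; rewrite abse_EFin lee_fin.
have gE : (\int[lam]_u `|(EFin \o g) u| = \int[lam]_u (g u)%:E)%E.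
  by apply: eq_integral => u _; rewrite /= ger0_norm.
rewrite gE in goo.
have If : lam.-integrable setT (EFin \o f).
  apply/integrableP; split; first exact/measurable_EFinP.
  exact: le_lt_trans goo.
split=> //; apply: le_trans (le_normr_Rintegral measurableT If) _.
by rewrite /Rintegral fine_le// ge0_fin_numE ?(le_lt_trans le)//;
   apply: integral_ge0 => u _; rewrite lee_fin.
Qed.

(** The factor 2 comes from estimating real and imaginary parts separately. Domination is only
    almost everywhere because the bound on the symbol is. *)
Lemma cintegrable_le f (g : (d + d).-tuple mR -> R) :
  cmeasurable f -> lam.-integrable setT (EFin \o g) -> (forall u, 0 <= g u) ->
  {ae lam, forall u, normc (f (cvec u)) <= g u} ->
  cintegrable f /\ normc (cintegral f) <= 2 * \int[lam]_u g u.
Proof.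
move=> [rf mf] ig g0 fg.
have [ir lr] : lam.-integrable setT (EFin \o (fun u => complex.Re (f (cvec u)))) /\
    `|\int[lam]_u complex.Re (f (cvec u))| <= \int[lam]_u g u.
  apply: ae_le_integrable => //; apply: filterS fg => u; apply: le_trans.
  exact: Re_norm_le_normc.
have [im lm] : lam.-integrable setT (EFin \o (fun u => complex.Im (f (cvec u)))) /\
    `|\int[lam]_u complex.Im (f (cvec u))| <= \int[lam]_u g u.
  apply: ae_le_integrable => //; apply: filterS fg => u; apply: le_trans.
  exact: Im_norm_le_normc.
split; first by split.
apply: le_trans (normc_le_ReIm _) _; rewrite mulr_natl mulr2n.
exact: lerD.
Qed.

Lemma cintegralD f g : cintegrable f -> cintegrable g ->
  cintegrable (fun w => f w + g w) /\
  cintegral (fun w => f w + g w) = cintegral f + cintegral g.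
Proof.
move=> [rf mf] [rg mg].
split.
  split.
    apply: (eq_integrable _ _ _ _ (integrableD measurableT rf rg)) => // u _.
    by rewrite raddfD.
  apply: (eq_integrable _ _ _ _ (integrableD measurableT mf mg)) => // u _.
  by rewrite raddfD.
rewrite /cintegral.
under eq_Rintegral do rewrite raddfD.
under [X in Complex _ X]eq_Rintegral do rewrite raddfD.
by rewrite !RintegralD.
Qed.

Lemma cintegralZ c f : cintegrable f ->
  cintegrable (fun w => c * (f w : R[i])) /\
  cintegral (fun w => c * (f w : R[i])) = c * cintegral f.
Proof.
case: c => a b [rf mf].
have ReE w : complex.Re (Complex a b * (f w : R[i])) =
    a * complex.Re (f w) + (- b) * complex.Im (f w).
  by case: (f w) => x y; rewrite /= mulNr.
have ImE w : complex.Im (Complex a b * (f w : R[i])) =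
    a * complex.Im (f w) + b * complex.Re (f w).
  by case: (f w) => x y.
have Z k (q : (d + d).-tuple mR -> R) : lam.-integrable setT (EFin \o q) ->
    lam.-integrable setT (EFin \o (fun u => k * q u)).
  by move=> iq; apply: eq_integrable (integrableZl measurableT k iq).
split.
  split.
    by apply: (eq_integrable _ _ _ _ (integrableD measurableT (Z a _ rf) (Z (- b) _ mf))) => // u _;
      rewrite ReE.
  by apply: (eq_integrable _ _ _ _ (integrableD measurableT (Z a _ mf) (Z b _ rf))) => // u _;
    rewrite ImE.
rewrite /cintegral.
under eq_Rintegral do rewrite ReE.
under [X in Complex _ X]eq_Rintegral do rewrite ImE.
rewrite !RintegralD ?RintegralZl//; try exact: Z.
by apply/eqP; rewrite eq_complex /= mulNr !eqxx.
Qed.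

End ComplexIntegral.

(** * Complex differentiability *)

Section Differentiability.
Context {R : realType} {d : nat}.
Local Notation C := (R[i]^o).
Local Notation Cd := 'rV[C]_d.
Local Notation normc := Normc.normc.

(** The norm of a vector over [R[i]] takes values in [R[i]]; nonnegativity makes it real, so that
    estimates can be carried out in [R]. *)
Lemma rV_normr_real (h : Cd) : `|h| = ((complex.Re `|h|)%:C)%C.
Proof.
have : (0 : R[i]) <= `|h| by exact: normr_ge0.
by case: `|h| => a b; rewrite lecE /= => /andP[/eqP -> _].
Qed.

Lemma rV_normr_ge0 (h : Cd) : 0 <= complex.Re `|h|.
Proof. by rewrite -ler0c -rV_normr_real; exact: normr_ge0. Qed.

Lemma normc_le_rV_normr (h : Cd) (j : 'I_d) : normc (h 0 j) <= complex.Re `|h|.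
Proof.
rewrite -lecR -rV_normr_real.
suff : `|h 0 j| <= `|h| by [].
rewrite {2}/Num.norm/= mx_normE.
exact: (le_bigmax _ (fun i : 'I_1 * 'I_d => `|h i.1 i.2|%:nng) (0, j)).
Qed.

(** [d.+1] is a crude replacement for the square root of [d], positive also for [d = 0]. *)
Lemma enorm_le_rV_normr (h : Cd) : enorm h <= d.+1%:R * complex.Re `|h|.
Proof.
have n0 := rV_normr_ge0 h; have D0 : 0 <= d.+1%:R * complex.Re `|h| by exact: mulr_ge0.
rewrite -(ger0_norm D0) -sqrtr_sqr ler_sqrt ?sqr_ge0//.
apply: le_trans (_ : \sum_(j < d) (complex.Re `|h|) ^+ 2 <= _).
  by apply: ler_sum => j _; rewrite lerXn2r ?nnegrE ?normc_ge0// normc_le_rV_normr.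
rewrite sumr_const card_ord.
rewrite exprMn -[leLHS]mulr_natl.
apply: ler_wpM2r; first exact: sqr_ge0.
by rewrite -natrX ler_nat -[leqLHS]muln1 leq_mul.
Qed.

(** A quadratic error is [o(h)]; the bound on [L] supplies the continuity required of a
    differential. *)
Lemma quadratic_differentiable (f : Cd -> C) (z : Cd) (L : {linear Cd -> C})
    (A B : R) : 0 <= A -> 0 <= B ->
  (forall h, normc (L h) <= A * enorm h) ->
  (forall h, enorm h <= 1 ->
     normc ((f (z + h) : R[i]) - f z - L h) <= B * enorm h ^+ 2) ->
  differentiable f z.
Proof.
move=> A0 B0 HL Hf.
have cL : continuous L.
  apply: bounded_linear_continuous; apply/linear_boundedP.
  near=> M => h.
  apply: le_trans (_ : ((A * d.+1%:R)%:C)%C * `|h| <= _).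
    rewrite [`|h|]rV_normr_real -rmorphM lecR.
    apply: le_trans (HL h) _; rewrite -mulrA ler_wpM2l//.
    exact: enorm_le_rV_normr.
  rewrite ler_wpM2r//; near: M; apply: nbhs_pinfty_ge.
  by rewrite complex_real.
have od : f \o shift z = cst (f z) + L +o_ (0 : Cd) id.
  apply/eqaddoP => e e0.
  have eE : e = ((complex.Re e)%:C)%C.
    by case: e e0 => a b; rewrite ltcE /= => /andP[/eqP ->].
  have e0' : 0 < complex.Re e by rewrite -ltcR -eE.
  pose D : R := d.+1%:R; have D0 : 0 < D by [].
  (* The first bound ensures [enorm h <= 1]; the second turns [B * (D * |h|) ^ 2] into at most
     [e * |h|]. *)
  pose r := Num.min D^-1 (complex.Re e / ((B + 1) * D ^+ 2)).
  have B1 : 0 < B + 1 by rewrite ltr_wpDl.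
  have r0 : 0 < r by rewrite lt_min invr_gt0 D0 divr_gt0// mulr_gt0// exprn_gt0.
  have nr : \forall h \near nbhs (0 : Cd), `|h| <= (r%:C)%C.
    by apply: (@nbhs0_le _ Cd); rewrite ltcR.
  near=> h.
  have hr : complex.Re `|h| <= r.
    by rewrite -lecR -rV_normr_real; near: h; exact: nr.
  have n0 := rV_normr_ge0 h.
  have [r1 r2] : complex.Re `|h| <= D^-1 /\
      complex.Re `|h| <= complex.Re e / ((B + 1) * D ^+ 2).
    by move: hr; rewrite /r le_min => /andP[].
  have hD := enorm_le_rV_normr h; rewrite -/D in hD.
  rewrite [`|id h|]rV_normr_real eE -rmorphM.
  have -> : (f \o shift z - (cst (f z) + L)) h = (f (z + h) : R[i]) - f z - L h.
    by rewrite !fctE /= opprD addrA (addrC h).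
  rewrite lecR; apply: le_trans (Hf h _) _.
    by apply: le_trans hD _; rewrite -ler_pdivlMl// mulr1.
  move: r2; rewrite ler_pdivlMr ?mulr_gt0 ?exprn_gt0// => r2.
  have : enorm h ^+ 2 <= (D * complex.Re `|h|) ^+ 2.
    by rewrite lerXn2r ?nnegrE ?enorm_ge0// mulr_ge0// ltW.
  move=> /(ler_wpM2l B0) /le_trans; apply; rewrite exprMn.
  rewrite (expr2 (complex.Re _)) !mulrA ler_wpM2r//.
  apply: le_trans r2; rewrite mulrC ler_wpM2l//.
  by rewrite -mulrA -expr2 ler_wpM2r ?sqr_ge0// lerDl.
apply/diff_locallyP; rewrite (diff_unique cL od); split => //.
Unshelve. all: by end_near. Qed.

End Differentiability.

(** * The anti-Wick operator on weighted spaces *)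

Section AntiWick.
Context {R : realType} {d : nat}.
Local Notation C := (R[i]^o).
Local Notation Cd := 'rV[C]_d.
Local Notation normc := Normc.normc.
Local Notation lam := (leb R (d + d)).
Implicit Types (F G : Cd -> C) (z w h : Cd).

(** With [p = 1 / s] this is the bound [Anorm s t (- r) F <= N] with the weight moved to the
    right-hand side, hence the sign of [r]. *)
Definition ae_growth (p t r N : R) F : Prop :=
  {ae lam, forall u, normc (F (cvec u)) <=
     N * expR (t * enorm (cvec u : Cd) ^+ 2 + r * enorm (cvec u : Cd) `^ p)}.

Context (p c r r0 rho del M : R) (a0 : Cd -> C).
Hypotheses (p02 : 0 < p < 2) (c0 : 0 < c) (rho0 : 0 <= rho) (del0 : 0 < del).
Hypothesis gap : rho * (4 * c) `^ p + r + del <= r0.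
Hypothesis ma0 : cmeasurable a0.
Hypothesis da0 : {ae lam, forall u,
  normc (a0 (cvec u)) <= M * expR (- r0 * enorm (cvec u : Cd) `^ p)}.

(** The reciprocal of the weight of the target step [rho]: for [c = 1 - t0] the coefficient
    [(4 * c)^-1] is [t1]. *)
Let gauss (x : R) : R := expR ((4 * c)^-1 * x ^+ 2 - rho * x `^ p).

(* The factor [G] lets one estimate serve the operator ([G = 1]), its
   differential ([G = herm h]) and the Taylor remainder. *)
Lemma aw_integrand_mul_le : exists2 B : R, 0 <= B &
  forall F G z (N A b : R), cmeasurable F -> cmeasurable G ->
    0 <= N -> 0 <= A -> 0 <= b ->
    ae_growth p (1 - c) r N F ->
    (forall w, normc (G w) <= A * expR (b * enorm w)) ->
    cintegrable (fun w => (aw_integrand a0 F z w : R[i]) * G w) /\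
    normc (cintegral (fun w => (aw_integrand a0 F z w : R[i]) * G w)) <=
      B * N * A * gauss (enorm z + b).
Proof.
have [K K0 HK] := mul_sub_sqr_le c p rho c0 p02 rho0.
have p0 : 0 < p by case/andP: p02.
have iE := integrable_expR_enorm (d := d) p del p0 del0.
pose I := \int[lam]_u expR (- (del * enorm (cvec u : Cd) `^ p)).
have I0 : 0 <= I by apply: Rintegral_ge0 => u _; exact: expR_ge0.
exists (2 * (`|M| * expR K * I)); first by rewrite !mulr_ge0 ?expR_ge0.
move=> F G z N A b mF mG N0 A0 b0 FN GA.
pose Q := `|M| * expR K * N * A * gauss (enorm z + b).
have Q0 : 0 <= Q by rewrite !mulr_ge0 ?expR_ge0.
have -> : 2 * (`|M| * expR K * I) * N * A * gauss (enorm z + b) = 2 * (Q * I).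
  by rewrite /Q; ring.
rewrite -[Q * I]RintegralZl//.
apply: cintegrable_le.
- apply: cmeasurableM => //; apply: cmeasurableM; first exact: cmeasurableM.
  apply: cmeasurable_cexp.
  have -> : (fun w => herm (z - w) w) = (fun w => herm z w + (-1) * herm w w).
    by apply/funext => w; rewrite hermBl mulN1r.
  apply: cmeasurableD; first exact: cmeasurable_herm.
  by apply: cmeasurableM; [exact: (cmeasurable_cst (-1)) | exact: cmeasurable_herm_self].
- by apply: eq_integrable (integrableZl measurableT Q iE).
- by move=> u; rewrite mulr_ge0 ?expR_ge0.
apply: filterS2 da0 FN => u; set w : Cd := cvec u => a0w Fw.
rewrite /aw_integrand !Normc.normcM.
have y0 := enorm_ge0 w; have x0 : 0 <= enorm z + b by rewrite addr_ge0 ?enorm_ge0.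
(* The factor [expR (b * enorm w)] from [G] is absorbed by replacing [enorm z] with [enorm z + b] in
   the exponent. *)
have HKw := HK _ _ x0 y0.
have Mw : normc (a0 w) <= `|M| * expR (- r0 * enorm w `^ p).
  by apply: le_trans a0w _; rewrite ler_wpM2r ?expR_ge0// ler_norm.
apply: le_trans (_ : `|M| * expR (- r0 * enorm w `^ p) *
  (N * expR ((1 - c) * enorm w ^+ 2 + r * enorm w `^ p)) *
  expR (enorm z * enorm w - enorm w ^+ 2) * (A * expR (b * enorm w)) <= _).
  by rewrite !ler_pM ?mulr_ge0 ?normc_ge0 ?normc_cexp_herm_le.
rewrite /Q /gauss.
set X := (X in X <= _); set Y := (Y in _ <= Y).
have -> : X = `|M| * N * A * expR (- r0 * enorm w `^ p +
    ((1 - c) * enorm w ^+ 2 + r * enorm w `^ p) +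
    (enorm z * enorm w - enorm w ^+ 2) + b * enorm w).
  by rewrite /X !expRD; ring.
have -> : Y = `|M| * N * A * expR (K + ((4 * c)^-1 * (enorm z + b) ^+ 2 -
    rho * (enorm z + b) `^ p) - del * enorm w `^ p).
  by rewrite /Y !expRD; ring.
rewrite ler_wpM2l ?mulr_ge0// ler_expR.
have : (rho * (4 * c) `^ p + r + del) * enorm w `^ p <= r0 * enorm w `^ p.
  by rewrite ler_wpM2r ?powR_ge0.
lra.
Qed.

Let pid_ge0 : 0 <= (pi : R) ^- d.
Proof. by rewrite invr_ge0 exprn_ge0// pi_ge0. Qed.

Lemma Op_aw_le : exists2 B : R, 0 <= B &
  forall F z (N : R), cmeasurable F -> 0 <= N -> ae_growth p (1 - c) r N F ->
    cintegrable (aw_integrand a0 F z) /\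
    normc (Op_aw a0 F z) <= B * N * gauss (enorm z).
Proof.
have [B B0 HB] := aw_integrand_mul_le.
exists (pi ^- d * B) => [|F z N mF N0 FN]; first by rewrite mulr_ge0.
have G1 w : normc (1 : C) <= 1 * expR (0 * enorm w).
  by rewrite mul0r expR0 mulr1 Normc.normc1.
have := HB F (fun=> 1) z N 1 0 mF (cmeasurable_cst 1) N0 ler01 (lexx 0) FN G1.
have -> : (fun w => (aw_integrand a0 F z w : R[i]) * (1 : C)) = aw_integrand a0 F z.
  by apply/funext => w; rewrite mulr1.
rewrite addr0 mulr1 => -[iF lF]; split => //.
rewrite /Op_aw Normc.normcM normc_real ger0_norm// -!mulrA ler_wpM2l//.
by rewrite mulrA.
Qed.

(** Moving [z] to [z + h] multiplies the integrand by [cexp (herm h w) = 1 + herm h w + rem h w].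
    The middle term integrates to the differential, which is complex linear in [h], and the last one
    to an error of order [|h| ^ 2]. *)
Lemma Op_aw_entire F (N : R) : cmeasurable F -> 0 <= N ->
  ae_growth p (1 - c) r N F -> entire (Op_aw a0 F).
Proof.
move=> mF N0 FN z; have [B B0 HB] := aw_integrand_mul_le.
pose Psi h w : C := (aw_integrand a0 F z w : R[i]) * herm h w.
pose rem h w : R[i] := cexp (herm h w) - 1 - herm h w.
have mrem h : cmeasurable (rem h).
  have -> : rem h = (fun w => cexp (herm h w) + (-1) + (-1) * herm h w).
    by apply/funext => w; rewrite mulN1r.
  have mh := cmeasurable_herm h.
  have m1 := cmeasurable_cst (d := d) (-1 : R[i]^o).
  by apply: cmeasurableD; [apply: cmeasurableD => //; exact: cmeasurable_cexp | exact: cmeasurableM].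
have hermA h w : normc (herm h w) <= enorm h * expR (1 * enorm w).
  apply: le_trans (herm_le h w) _; rewrite ler_wpM2l ?enorm_ge0// mul1r.
  by apply: le_trans (expR_ge1Dx _); rewrite lerDr.
have iPsi h : cintegrable (Psi h) /\
    normc (cintegral (Psi h)) <= B * N * enorm h * gauss (enorm z + 1).
  by apply: HB => //; [exact: cmeasurable_herm | exact: enorm_ge0].
have iF : cintegrable (aw_integrand a0 F z).
  have [B' _ /(_ F z N mF N0 FN)[]] := Op_aw_le; by [].
(* One [expR (enorm w)] comes from the Taylor bound, using [enorm h <= 1]; the other absorbs
   [enorm w ^ 2] at the cost of a factor 4. *)
have remA h : enorm h <= 1 -> forall w,
    normc (rem h w) <= 16 * enorm h ^+ 2 * expR (2 * enorm w).
  move=> h1 w; apply: le_trans (cexp_sub1x_normc_le _) _.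
  have hw := herm_le h w; have y0 := enorm_ge0 w; have h0 := enorm_ge0 h.
  have n0 := normc_ge0 (herm h w).
  have e1 : expR (normc (herm h w)) <= expR (enorm w).
    by rewrite ler_expR (le_trans hw)// ler_piMl.
  have e2 : normc (herm h w) ^+ 2 <= enorm h ^+ 2 * (4 * expR (enorm w)).
    apply: le_trans (_ : (enorm h * enorm w) ^+ 2 <= _).
      by rewrite lerXn2r ?nnegrE// mulr_ge0.
    by rewrite exprMn ler_wpM2l ?sqr_ge0// sqr_le_expR.
  have -> : 16 * enorm h ^+ 2 * expR (2 * enorm w) =
      4 * (enorm h ^+ 2 * (4 * expR (enorm w))) * expR (enorm w).
    by rewrite (mulr_natl (enorm w) 2) mulr2n expRD; ring.
  by rewrite ler_pM ?mulr_ge0 ?sqr_ge0 ?expR_ge0// ler_wpM2l.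
have irem h : enorm h <= 1 ->
    cintegrable (fun w => (aw_integrand a0 F z w : R[i]) * rem h w) /\
    normc (cintegral (fun w => (aw_integrand a0 F z w : R[i]) * rem h w)) <=
      B * N * (16 * enorm h ^+ 2) * gauss (enorm z + 2).
  move=> h1; apply: HB => //; first by rewrite mulr_ge0// sqr_ge0.
  exact: remA.
pose L h : C := ((pi ^- d)%:C)%C * cintegral (Psi h).
have Llin : linear L.
  move=> a h h'.
  have [iZ eZ] := cintegralZ a _ (iPsi h).1.
  have [_ eD] := cintegralD _ _ iZ (iPsi h').1.
  rewrite /L.
  have -> : Psi (a *: h + h') = (fun w => (a : R[i]) * Psi h w + Psi h' w).
    apply/funext => w; rewrite /Psi hermDl hermZl; ring.
  by rewrite eD eZ mulrDr mulrCA.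
pose LL : {linear Cd -> C} := HB.pack L (GRing.isLinear.Build _ _ _ _ L Llin).
apply: (@quadratic_differentiable _ _ _ _ LL
  (pi ^- d * (B * N * gauss (enorm z + 1)))
  (pi ^- d * (B * N * 16 * gauss (enorm z + 2)))).
- by rewrite !mulr_ge0 ?expR_ge0.
- by rewrite !mulr_ge0 ?expR_ge0.
- move=> h; rewrite [LL h]/(L h) Normc.normcM normc_real ger0_norm//.
  rewrite -!mulrA ler_wpM2l//; apply: le_trans (iPsi h).2 _.
  by rewrite le_eqVlt; apply/orP; left; apply/eqP; ring.
- move=> h h1; have [iR lR] := irem h h1.
  have [iD eD] := cintegralD _ _ (iPsi h).1 iR.
  have [_ eD'] := cintegralD _ _ iF iD.
  have E : aw_integrand a0 F (z + h) = (fun w => aw_integrand a0 F z w +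
      (Psi h w + (aw_integrand a0 F z w : R[i]) * rem h w)).
    apply/funext => w; rewrite /Psi /rem /aw_integrand.
    have -> : herm (z + h - w) w = herm (z - w) w + herm h w.
      by rewrite addrAC hermDl.
    rewrite cexpD; ring.
  have -> : (Op_aw a0 F (z + h) : R[i]) - Op_aw a0 F z - LL h =
      ((pi ^- d)%:C)%C * cintegral (fun w => (aw_integrand a0 F z w : R[i]) * rem h w).
    rewrite [LL h]/(L h) /Op_aw /L E eD' eD; ring.
  rewrite Normc.normcM normc_real ger0_norm// -[leRHS]mulrA ler_wpM2l//.
  apply: le_trans lR _.
  by rewrite le_eqVlt; apply/orP; left; apply/eqP; ring.
Qed.

End AntiWick.

(** * Norms and limit topologies *)

Section Seminorm.
Context {R : realType} {d : nat} (s t r : R).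
Local Notation C := (R[i]^o).
Local Notation Cd := 'rV[C]_d.
Local Notation normc := Normc.normc.
Local Notation lam := (leb R (d + d)).
Implicit Types (F G : Cd -> C).

(* The library sets the [L^oo] norm to [0] when the total mass vanishes; in
   that case every property holds almost everywhere. *)
Lemma Anorm_leP F (N : R) : 0 <= N ->
  (Anorm s t r F <= N%:E)%E <-> ae_growth s^-1 t (- r) N F.
Proof.
move=> N0.
have E u : (`|normc (F (cvec u)) * expR (- t * enorm (cvec u : Cd) ^+ 2 +
      r * enorm (cvec u : Cd) `^ s^-1)| <= N) =
    (normc (F (cvec u)) <= N * expR (t * enorm (cvec u : Cd) ^+ 2 +
      (- r) * enorm (cvec u : Cd) `^ s^-1)).
  rewrite ger0_norm ?mulr_ge0 ?normc_ge0 ?expR_ge0//.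
  by rewrite -ler_pdivlMr ?expR_gt0// -expRN opprD !mulNr opprK.
rewrite /Anorm unlock /Lnorm; case: ifPn => lam0.
  split.
    move=> /ess_supP; apply: filterS => u /=.
    by rewrite lee_fin E.
  move=> FN; apply/ess_supP; apply: filterS FN => u /=.
  by rewrite lee_fin E.
split=> _; last by rewrite lee_fin.
have lamT : lam setT = 0%E.
  by apply/eqP; rewrite eq_le measure_ge0 andbT leNgt.
by exists setT; split.
Qed.

(** The norm itself serves as [N]. With [e = +oo] this extracts a real bound from membership in
    [Aset]; with finite [e] it leaves the slack needed to show that balls are open. *)
Lemma Anorm_fin F (e : \bar R) : (Anorm s t r F < e)%E ->
  exists N : R, [/\ 0 <= N, (N%:E < e)%E & ae_growth s^-1 t (- r) N F].
Proof.
move=> Fe; have F0 : (0 <= Anorm s t r F)%E by exact: Lnorm_ge0.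
have Ff : (Anorm s t r F \is a fin_num).
  by rewrite ge0_fin_numE// (lt_le_trans Fe)// leey.
exists (fine (Anorm s t r F)); rewrite fineK//; split=> //.
  exact: fine_ge0.
by apply/Anorm_leP; rewrite ?fine_ge0// fineK.
Qed.

Lemma ae_growth_lin (p t' r' N N' : R) F G (a b : R[i]) :
  ae_growth p t' r' N F -> ae_growth p t' r' N' G ->
  ae_growth p t' r' (normc a * N + normc b * N') (a *: F + b *: G).
Proof.
apply: filterS2 => u FN GN; rewrite mulrDl -!mulrA.
apply: le_trans (le_normcD _ _) _.
by apply: lerD; rewrite Normc.normcM ler_wpM2l ?normc_ge0.
Qed.

Lemma norm_open_ball (F : Aspace d s t r) (e : R) :
  norm_open [set G : Aspace d s t r | (Anorm s t r (sval G - sval F)%R < e%:E)%E].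
Proof.
move=> G /= /Anorm_fin[N [N0 Ne GF]].
exists (e - N); first by rewrite subr_gt0 -lte_fin.
move=> H /Anorm_fin[N' [N'0 N'e HG]].
apply: (@le_lt_trans _ _ (N + N')%:E); last by move: N'e; rewrite !lte_fin; lra.
apply/Anorm_leP; first exact: addr_ge0.
have -> : sval H - sval F = 1 *: (sval G - sval F) + 1 *: (sval H - sval G).
  by rewrite !scale1r [RHS]addrC addrA subrK.
have := ae_growth_lin _ _ _ _ _ _ _ 1 1 GF HG.
by rewrite Normc.normc1 !mul1r.
Qed.

Lemma Aset_sub F G : Aset s t r F -> Aset s t r G -> Aset s t r (F - G).
Proof.
move=> [eF Foo] [eG Goo]; split; first by move=> z; apply: differentiableB.
have [N [N0 _ FN]] := Anorm_fin _ _ Foo.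
have [N' [N'0 _ GN]] := Anorm_fin _ _ Goo.
have := ae_growth_lin _ _ _ _ _ _ _ 1 (-1) FN GN.
rewrite scale1r scaleN1r normcN Normc.normc1 !mul1r => FG.
apply: le_lt_trans (ltry (N + N')); apply/Anorm_leP => //.
exact: addr_ge0.
Qed.

End Seminorm.

(** * Boundedness of the operator between steps of the two scales *)

Section AntiWickSpaces.
Context {R : realType} {d : nat}.
Local Notation C := (R[i]^o).
Local Notation Cd := 'rV[C]_d.
Local Notation normc := Normc.normc.
Implicit Types (F G : Cd -> C).

Lemma entire_cmeasurable F : entire F -> cmeasurable F.
Proof.
move=> eF; apply: continuous_cmeasurable => z.
exact/differentiable_continuous/eF.
Qed.

Lemma Op_aw_lin (a0 : Cd -> C) F G (a b : R[i]) :
  (forall z, cintegrable (aw_integrand a0 F z)) ->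
  (forall z, cintegrable (aw_integrand a0 G z)) ->
  Op_aw a0 (a *: F + b *: G) = a *: Op_aw a0 F + b *: Op_aw a0 G.
Proof.
move=> iF iG; apply/funext => z.
have [iaF eaF] := cintegralZ a _ (iF z).
have [ibG ebG] := cintegralZ b _ (iG z).
have [_ eD] := cintegralD _ _ iaF ibG.
have E : aw_integrand a0 (a *: F + b *: G) z =
    (fun w => a * (aw_integrand a0 F z w : R[i]) + b * (aw_integrand a0 G z w : R[i])).
  apply/funext => w; rewrite /aw_integrand.
  have -> : (a *: F + b *: G) w = a * (F w : R[i]) + b * (G w : R[i]) by [].
  ring.
rewrite /Op_aw E eD eaF ebG.
rewrite -[RHS]/(a * _ + b * _ : R[i]); ring.
Qed.

(** Translates the pointwise growth estimates into norms. [B] is chosen before [F], which is what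
    continuity in the limit topologies needs. *)
Lemma Op_aw_bounded (s t0 t1 r rho del r0 : R) (a0 : Cd -> C) :
  2^-1 < s -> cmeasurable a0 -> 0 < t0 < 1 -> t1 = (4 * (1 - t0))^-1 ->
  0 <= rho -> 0 < del -> rho * (4 * (1 - t0)) `^ s^-1 + r + del <= r0 ->
  decays s a0 r0 ->
  exists2 B : R, 0 <= B & forall F, Aset s t0 (- r) F ->
    [/\ forall z, cintegrable (aw_integrand a0 F z),
        Aset s t1 rho (Op_aw a0 F) &
        forall N : R, 0 <= N -> (Anorm s t0 (- r) F <= N%:E)%E ->
          (Anorm s t1 rho (Op_aw a0 F) <= (B * N)%:E)%E].
Proof.
move=> s2 ma0 /andP[t00 t01] t1E rho0 del0 gap [M da0].
have s0 : 0 < s by apply: lt_trans s2; rewrite invr_gt0.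
(* The hypothesis [s > 1/2] says that the exponent [p = 1 / s] is below that of the Gaussian. *)
have p02 : 0 < s^-1 < 2.
  by rewrite invr_gt0 s0/= -[ltRHS]invrK ltf_pV2 ?posrE ?invr_gt0.
have c0 : 0 < 1 - t0 by rewrite subr_gt0.
have [B B0 HB] := Op_aw_le s^-1 (1 - t0) r r0 rho del M a0 p02 c0 rho0 del0 gap ma0 da0.
have HE := Op_aw_entire s^-1 (1 - t0) r r0 rho del M a0 p02 c0 rho0 del0 gap ma0 da0.
have tE : 1 - (1 - t0) = t0 by rewrite subKr.
rewrite tE in HB HE.
have bnd F N : entire F -> 0 <= N -> (Anorm s t0 (- r) F <= N%:E)%E ->
    (Anorm s t1 rho (Op_aw a0 F) <= (B * N)%:E)%E.
  move=> eF N0 /(Anorm_leP _ _ _ _ _ N0); rewrite opprK => FN.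
  apply/Anorm_leP; first exact: mulr_ge0.
  have mF := entire_cmeasurable _ eF.
  apply: aeW => u; have [_] := HB F (cvec u) N mF N0 FN.
  by rewrite -t1E mulNr.
exists B; [exact: B0 | move=> F [eF Foo]].
have mF := entire_cmeasurable _ eF.
have [N [N0 _ FN]] := Anorm_fin _ _ _ _ _ Foo; rewrite opprK in FN.
split.
- by move=> z; have [] := HB F z N mF N0 FN.
- split; first exact: HE FN.
  apply: le_lt_trans (ltry (B * N)); apply: bnd => //.
  by apply/Anorm_leP => //; rewrite opprK.
- by move=> N' N'0; exact: bnd.
Qed.

End AntiWickSpaces.

(** * Continuity criteria for maps between inductive and projective limits *)

Section Continuity.
Context {R : realType} {d : nat}.
Local Notation C := (R[i]^o).
Local Notation Cd := 'rV[C]_d.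
Local Notation normc := Normc.normc.

(** Continuity into a projective limit is tested on each step [j]. There, linearity makes the
    preimage of a ball absolutely convex, and boundedness from every step [i] makes its trace on
    that step a neighbourhood of 0. *)
Lemma continuous_ind_proj (s t s' t' : R) (I J : Type) (rho : I -> R) (sig : J -> R)
    (T : ind_lim d s t rho -> proj_lim d s' t' sig) :
  (forall (F G H : ind_lim d s t rho) (a b : R[i]),
     sval H = a *: sval F + b *: sval G ->
     sval (T H) = a *: sval (T F) + b *: sval (T G)) ->
  (forall i j, exists2 B : R, 0 <= B & forall (F : Aspace d s t (rho i)) (N : R),
     0 <= N -> (Anorm s t (rho i) (sval F) <= N%:E)%E ->
     (Anorm s' t' (sig j) (sval (T (ind_from F))) <= (B * N)%:E)%E) ->
  continuous T.
Proof.
move=> linT bndT.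
have step j : continuous (proj_to j \o T : ind_lim d s t rho -> Aspace d s' t' (sig j)).
  apply/continuousP => U oU.
  suff : ind_open ((proj_to j \o T) @^-1` U) by [].
  move=> F UF; have [e e0 eU] := (oU : norm_open U) _ UF.
  have e2 : 0 < e / 2 by rewrite divr_gt0.
  (* A closed ball of half the radius: the closed form matches [Anorm_leP], and halving recovers the
     strict inequality for [eU]. *)
  exists [set H : ind_lim d s t rho |
      (Anorm s' t' (sig j) (sval (T H)) <= (e / 2)%:E)%E].
    split=> [F' G H a b /(Anorm_leP _ _ _ _ _ (ltW e2)) F'e
        /(Anorm_leP _ _ _ _ _ (ltW e2)) Ge ab HE|i] /=.
      have := ae_growth_lin _ _ _ _ _ _ _ a b F'e Ge; rewrite -(linT _ _ _ _ _ HE).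
      move=> /Anorm_leP h; apply: le_trans (h _) _.
        by rewrite addr_ge0// mulr_ge0 ?normc_ge0// ltW.
      by rewrite lee_fin -mulrDl ler_piMl// ltW.
    have [B B0 HB] := bndT i j; have B1 : 0 < B + 1 by rewrite ltr_wpDl.
    (* Dividing by [B + 1] also covers [B = 0]. *)
    have d0 : 0 < e / 2 / (B + 1) by rewrite divr_gt0.
    exists (e / 2 / (B + 1)); [exact: d0 | move=> G Ge].
    apply: le_trans (HB G _ (ltW d0) (ltW Ge)) _.
    by rewrite lee_fin mulrCA ler_piMr ?(ltW e2)// ler_pdivrMr// mul1r lerDl.
  move=> G H /= He GE; apply: eU => /=.
  have GE1 : sval G = 1 *: sval F + 1 *: sval H by rewrite !scale1r.
  rewrite (linT _ _ _ _ _ GE1) !scale1r addrC addKr.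
  by apply: le_lt_trans He _; rewrite lte_fin ltr_pdivrMr// ltr_pMr// ltr1n.
move=> F; have FF : Filter (T @ F) := fmap_filter _ (nbhs_filter F).
apply/cvg_sup => j.
exact: (continuous_comp_initial (step j)).
Qed.

(** A single pair of steps suffices: a neighbourhood in the inductive limit contains a translated
    ball of step [j], and the preimage of a ball of step [i] is a neighbourhood in the projective
    limit. [H] is the difference of the two images, exhibited in step [j]. *)
Lemma continuous_proj_ind (s t s' t' : R) (I J : Type) (rho : I -> R) (sig : J -> R)
    (T : proj_lim d s t rho -> ind_lim d s' t' sig) (i : I) (j : J) (B : R) :
  0 <= B ->
  (forall (F G : proj_lim d s t rho), exists H : Aspace d s' t' (sig j),
     sval (T G) = sval (T F) + sval H /\
     forall N : R, 0 <= N -> (Anorm s t (rho i) (sval G - sval F)%R <= N%:E)%E ->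
       (Anorm s' t' (sig j) (sval H) <= (B * N)%:E)%E) ->
  continuous T.
Proof.
move=> B0 bndT F A; rewrite nbhsE => -[U [oU UF] UA].
have [V [_ nV] VU] := oU _ UF; have [e e0 eV] := nV j.
have B1 : 0 < B + 1 by rewrite ltr_wpDl.
have d0 : 0 < e / (B + 1) by rewrite divr_gt0.
pose W := [set G : Aspace d s t (rho i) |
  (Anorm s t (rho i) (sval G - sval (proj_to i F))%R < (e / (B + 1))%:E)%E].
have WF : nbhs (proj_to i F) W.
  apply: open_nbhs_nbhs; split; first exact: norm_open_ball.
  apply: (@le_lt_trans _ _ 0%:E); last by rewrite lte_fin.
  apply/Anorm_leP => //; rewrite subrr; apply: aeW => u.
  by rewrite mul0r Normc.normc0.
have cp : proj_to i @ F --> proj_to i F.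
  have /cvg_sup/(_ i) Fi : nbhs F --> F by [].
  by move=> P /(@initial_continuous _ _ (@proj_to R d s t I rho i) F); exact: Fi.
have WF' : nbhs F (proj_to i @^-1` W) := cp _ WF.
suff : nbhs F (T @^-1` A) by [].
apply: (@filterS _ _ (nbhs_filter F) _ _ _ WF') => G WG; apply: UA.
have [H [GE HB]] := bndT F G.
apply: (VU _ (ind_from H)) => //; apply: eV.
apply: le_lt_trans (HB _ (ltW d0) (ltW WG)) _.
by rewrite lte_fin mulrCA gtr_pMr// ltr_pdivrMr// mul1r ltrDl.
Qed.

End Continuity.

Theorem proposition4p9 (R : realType) (d : nat) (s t0 t1 : R)
    (a0 : 'rV[R[i]^o]_d -> R[i]^o) :
  2^-1 < s -> Linfty_loc a0 -> 0 < t0 < 1 -> t1 = (4 * (1 - t0))^-1 ->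
  ((forall r0 : R, 0 < r0 -> decays s a0 r0) ->
   exists T : calA0' d s t0 -> calA0 d s t1,
     [/\ forall (F : calA0' d s t0) z,
           cintegrable (aw_integrand a0 (sval F) z),
         forall F : calA0' d s t0, sval (T F) = Op_aw a0 (sval F)
       & continuous T]) /\
  ((exists2 r0 : R, 0 < r0 & decays s a0 r0) ->
   exists T : calA' d s t0 -> calA d s t1,
     [/\ forall (F : calA' d s t0) z,
           cintegrable (aw_integrand a0 (sval F) z),
         forall F : calA' d s t0, sval (T F) = Op_aw a0 (sval F)
       & continuous T]).
Proof.
move=> s2 [ma0 _] t01 t1E; have c0 : 0 < 1 - t0 by case/andP: t01; rewrite subr_gt0.
have c40 : 0 < (4 * (1 - t0)) `^ s^-1 by rewrite powR_gt0// mulr_gt0.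
split=> [dec|[r0 r00 dec]].
- have pos (r : {posnum R}) : 0 < r%:num by [].
  (* As every decay rate is available, take the one that makes the gap condition an equality with
     [del = 1]; this works for all pairs of steps. *)
  have bnd (r rho : {posnum R}) := Op_aw_bounded s t0 t1 r%:num rho%:num 1
    (rho%:num * (4 * (1 - t0)) `^ s^-1 + r%:num + 1) a0 s2 ma0 t01 t1E
    (ltW (pos rho)) ltr01 (lexx _)
    (dec _ (addr_gt0 (addr_gt0 (mulr_gt0 (pos rho) c40) (pos r)) ltr01)).
  have mem (F : calA0' d s t0) : exists r : {posnum R}, Aset s t0 (- r%:num) (sval F).
    by have [r _ Fr] := set_mem (svalP F); exists r.
  have TF (F : calA0' d s t0) :
      (\bigcap_(rho : {posnum R}) Aset s t1 rho%:num) (Op_aw a0 (sval F)).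
    move=> rho _; have [r Fr] := mem F.
    by have [B _ /(_ _ Fr)[]] := bnd r rho.
  have iF (F : calA0' d s t0) z : cintegrable (aw_integrand a0 (sval F) z).
    have [r Fr] := mem F.
    (* Integrability does not involve the target step, so any value of [rho] serves. *)
    by have [B _ /(_ _ Fr)[]] := bnd r 1%:pos.
  exists (fun F => exist _ (Op_aw a0 (sval F)) (mem_set (TF F))); split => //.
  apply: continuous_ind_proj => /=.
    by move=> F G H a b ->; apply: Op_aw_lin; exact: iF.
  move=> r rho; have [B B0 HB] := bnd r rho; exists B => // F N N0 FN.
  have [_ _] := HB _ (set_mem (svalP F)); exact.
(* The rate [r0] is shared equally between the growth [r] of the source, the margin [del] and the
   term [rho * (4 * (1 - t0)) ^ (1 / s)]; the last share determines [rho]. *)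
- have r30 : 0 < r0 / 3 by rewrite divr_gt0.
  pose r := PosNum r30.
  have rho0 : 0 < r0 / 3 / (4 * (1 - t0)) `^ s^-1 by rewrite divr_gt0.
  pose rho := PosNum rho0.
  have gap : rho%:num * (4 * (1 - t0)) `^ s^-1 + r%:num + r0 / 3 <= r0.
    by rewrite /= divfK ?gt_eqF//; lra.
  have [B B0 HB] := Op_aw_bounded s t0 t1 r%:num rho%:num (r0 / 3) r0 a0 s2 ma0 t01 t1E
    (ltW rho0) r30 gap dec.
  have mem (F : calA' d s t0) : Aset s t0 (- r%:num) (sval F).
    exact: (set_mem (svalP F) r).
  have TF (F : calA' d s t0) :
      (\bigcup_(rho : {posnum R}) Aset s t1 rho%:num) (Op_aw a0 (sval F)).
    by exists rho => //; have [] := HB _ (mem F).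
  have iF (F : calA' d s t0) z : cintegrable (aw_integrand a0 (sval F) z).
    by have [] := HB _ (mem F).
  exists (fun F => exist _ (Op_aw a0 (sval F)) (mem_set (TF F))); split => //.
  apply: (@continuous_proj_ind _ _ _ _ _ _ _ _ _ _ _ r rho B) => // F G /=.
  have FG := Aset_sub _ _ _ _ _ (mem G) (mem F).
  have [iFG aFG bFG] := HB _ FG.
  (* By linearity the image of [G - F] is the difference of the images, and boundedness places it in
     the step [rho]. *)
  exists (exist _ (Op_aw a0 (sval G - sval F)) (mem_set aFG) : Aspace d s t1 rho%:num).
  split => //=.
  have := Op_aw_lin a0 _ _ 1 1 (iF F) iFG.
  by rewrite !scale1r addrC subrK.
Qed.
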